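(* Let $1\le p<\infty$, let $(X,d)$ be a compact metric space, let $\mu\in\mathcal{P}(X)$, let $Y_1,Y_2,\ldots$ be i.i.d. $X$-valued random elements with common distribution $\mu$ defined on a complete probability space $(\Omega,\mathcal{F},\mathbb{P})$, and let $\bar\mu_n=\frac1n\sum_{i=1}^n\delta_{Y_i}$. Then the function $I_{p,\mu}:(\mathrm{K}(X),\tau_H^+)\to[0,\infty]$ defined by $$I_{p,\mu}(C)=\inf\{H(\nu\,|\,\mu):\nu\in\mathcal{P}(X),\ F_p(\nu)\supseteq C\}$$ has compact sublevel sets $\{C\in \mathrm{K}(X): I_{p,\mu}(C)\le\alpha\}$, and has the property that, for any $A\in\mathcal{B}(\tau_H^+)$, $$\limsup_{n\to\infty}\frac1n\log\mathbb{P}\{F_p(\bar\mu_n)\in A\}\le-\inf\{I_{p,\mu}(C):C\in\bar A\},$$ where $\bar A$ is the closure of $A$ in $\tau_H^+$. Consequently, for any $\varepsilon>0$ there exist constants $c_1,c_2>0$ (depending on $(X,d)$, $\mu$, $p$, and $\varepsilon$) such that $$\mathbb{P}\{\rho(F_p(\bar\mu_n),F_p(\mu))\ge\varepsilon\}\le c_1\exp(-c_2n)\qquad\text{for all } n\in\mathbb{N}.$$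
   Context: $\mathcal{P}(X)$ is the set of Borel probability measures on $X$. For $\nu\in\mathcal{P}(X)$ ($X$ compact), $F_p(\nu)=\arg\min_{x\in X}\int_X d^p(x,y)\,d\nu(y)$, which is a non-empty compact set. $\mathrm{K}(X)$ is the collection of non-empty compact subsets of $X$. For $C,C'\in\mathrm{K}(X)$, $\rho(C,C')=\max_{x\in C}\min_{x'\in C'}d(x,x')$. The upper Hausdorff topology $\tau_H^+$ on $\mathrm{K}(X)$ is the topology in which a net $\{C_\alpha\}$ converges to $C$ if and only if $\rho(C_\alpha,C)\to0$ (the sets $\{C':\rho(C',C)<\varepsilon\}$, $\varepsilon>0$, form a neighborhood base at $C$); it is in general not Hausdorff ($T_2$). $\mathcal{B}(\tau_H^+)$ is its Borel $\sigma$-algebra. Compactness means that every open cover has a finite subcover. The relative entropy is $H(\nu\,|\,\mu)=\int_X\log\left(\frac{d\nu}{d\mu}\right)d\nu$ if $\nu\ll\mu$ and $H(\nu\,|\,\mu)=\infty$ otherwise. Conventions: $\inf\emptyset=\infty$, $\log 0=-\infty$. *)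

(* Defs.v *)
From HB Require Import structures.
From mathcomp Require Import all_boot all_order all_algebra finmap.
From mathcomp Require Import all_classical all_reals all_analysis.
From mathcomp Require Import measurable_realfun ring lra.

Set Implicit Arguments.
Unset Strict Implicit.
Unset Printing Implicit Defensive.

Import Order.TTheory GRing.Theory Num.Theory.
Import numFieldNormedType.Exports.

Local Open Scope classical_set_scope.
Local Open Scope ring_scope.

(* A measurableType must be pointed; a space carrying a
   probability measure is nonempty, so asking for a point costs nothing. *)
#[short(type="pmetricType")]
HB.structure Definition PointedMetric (K : numDomainType) :=
  {M of Pointed M & Metric K M}.

Definition borel_display (T : ptopologicalType) : measure_display :=
  (@open T).-sigma.

Definition borel (T : ptopologicalType) : measurableType (borel_display T) :=
  g_sigma_algebraType (@open T).

Record kset (R : realType) (X : metricType R) := KSet {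
  kset_set :> set X ;
  kset_neq0 : kset_set !=set0 ;
  kset_compact : compact kset_set }.

HB.instance Definition _ (R : realType) (X : metricType R) :=
  gen_eqMixin (kset X).
HB.instance Definition _ (R : realType) (X : metricType R) :=
  gen_choiceMixin (kset X).

(* For nonempty compact sets the supremum and the infimum are attained, so this
   is max_{x in C} min_{x' in C'} d(x, x'). *)
Definition rho (R : realType) (X : metricType R) (C C' : set X) : R :=
  sup [set inf [set mdist x x' | x' in C'] | x in C].

Section rho_theory.
Context {R : realType} {X : metricType R}.
Implicit Types (C : kset X) (x : X) (e : R).

Lemma inf_mdist_has_inf C x : has_inf [set mdist x x' | x' in C].
Proof.
split; first by case: (kset_neq0 C) => c Cc; exists (mdist x c); exists c.
by exists 0 => _ [y _ <-]; exact: mdist_ge0.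
Qed.

Lemma inf_mdist_le C x c : kset_set C c ->
  inf [set mdist x x' | x' in C] <= mdist x c.
Proof.
by move=> Cc; apply: inf_lbound; [case: (inf_mdist_has_inf C x)|exists c].
Qed.

Lemma inf_mdist_lt C x e : inf [set mdist x x' | x' in C] < e ->
  exists2 c, kset_set C c & mdist x c < e.
Proof.
move=> /(inf_lt (inf_mdist_has_inf C x).1) [_ [c Cc <-] ce].
by exists c.
Qed.

Lemma mdist_continuousr x : continuous (fun y => mdist x y : R^o).
Proof.
move=> y; apply/cvgrPdist_lt => e e0.
near=> z.
have yz : mdist y z < e.
  have : ball y e z by near: z; exact: nbhsx_ballx.
  by rewrite ballEmdist.
have h1 := metric_triangle x y z; have h2 := metric_triangle x z y.
rewrite (metric_sym z y) in h2.
by rewrite ltr_norml; apply/andP; split; lra.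
Unshelve. all: by end_near. Qed.

Lemma mdist_bounded (A : set X) x : compact A ->
  exists M : R, forall y, A y -> mdist x y <= M.
Proof.
move=> cA.
have /compact_bounded : compact [set (mdist x y : R^o) | y in A].
  apply: continuous_compact => //.
  by apply: continuous_subspaceT => y; exact: mdist_continuousr.
move=> [M [_ MA]]; exists (M + 1) => y Ay.
apply: le_trans (ler_norm _) _.
by apply: (MA (M + 1)); [rewrite ltrDl|exists y].
Qed.

Lemma rho_has_sup C C' :
  has_sup [set inf [set mdist x x' | x' in C'] | x in C].
Proof.
have [c Cc] := kset_neq0 C; split.
  by exists (inf [set mdist c x' | x' in C']); exists c.
have [c' Cc'] := kset_neq0 C'.
have [M MC] := mdist_bounded c' (@kset_compact _ _ C).
exists M => _ [x Cx <-].
by rewrite (le_trans (inf_mdist_le x Cc'))// metric_sym MC.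
Qed.

Lemma rho_lt C C' e : rho C C' < e ->
  forall x, kset_set C x -> exists2 x', kset_set C' x' & mdist x x' < e.
Proof.
move=> Ce x Cx; apply: inf_mdist_lt; apply: le_lt_trans Ce.
by apply: ub_le_sup; [case: (rho_has_sup C C')|exists x].
Qed.

Lemma rho_le C C' e : 
    (forall x, kset_set C x -> exists2 x', kset_set C' x' & mdist x x' <= e) ->
  rho C C' <= e.
Proof.
move=> CC'; apply: ge_sup; first by case: (rho_has_sup C C').
by move=> _ [x /CC'[x' C'x' xe] <-]; rewrite (le_trans (inf_mdist_le x C'x')).
Qed.

Lemma rhoxx C : rho C C <= 0.
Proof. by apply: rho_le => x Cx; exists x => //; rewrite mdistxx. Qed.

Lemma rho_triangle C1 C2 C3 : rho C1 C3 <= rho C1 C2 + rho C2 C3.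
Proof.
apply/ler_addgt0Pl => e e0; apply: rho_le => x C1x.
have [y C2y xy] : exists2 y, kset_set C2 y & mdist x y < rho C1 C2 + e / 2.
  by apply: (@rho_lt C1) => //; rewrite ltrDl divr_gt0.
have [z C3z yz] : exists2 z, kset_set C3 z & mdist y z < rho C2 C3 + e / 2.
  by apply: (@rho_lt C2) => //; rewrite ltrDl divr_gt0.
exists z => //; have := metric_triangle x y z; lra.
Qed.

End rho_theory.

(* The upper Hausdorff topology: C' is close to C when C' lies in a small
   neighborhood of C, whence the order of the arguments of rho. *)
Section upper_hausdorff.
Context {R : realType} {X : metricType R}.

Definition kset_nbhs (C : kset X) : set_system (kset X) :=
  filter_from [set e : R | 0 < e] (fun e => [set C' : kset X | rho C' C < e]).

HB.instance Definition _ := hasNbhs.Build (kset X) kset_nbhs.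

Let kset_nbhs_filter (C : kset X) : ProperFilter (nbhs C).
Proof.
apply: filter_from_proper; last first.
  by move=> e /= e0; exists C; exact: le_lt_trans (rhoxx C) e0.
apply: filter_from_filter; first by exists 1 => /=.
move=> e1 e2 /= e10 e20; exists (Num.min e1 e2) => /=.
  by rewrite lt_min e10 e20.
by move=> C' /=; rewrite lt_min => /andP.
Qed.

Let kset_nbhs_singleton (C : kset X) (A : set (kset X)) : nbhs C A -> A C.
Proof. by move=> [e /= e0]; apply => /=; exact: le_lt_trans (rhoxx C) e0. Qed.

Let kset_nbhs_nbhs (C : kset X) (A : set (kset X)) :
  nbhs C A -> nbhs C (nbhs^~ A).
Proof.
move=> [e /= e0 eA]; exists e => //= C' C'C.
exists (e - rho C' C) => /=; first by rewrite subr_gt0.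
move=> C'' /= C''C'; apply: eA => /=.
by apply: le_lt_trans (rho_triangle _ C' _) _; rewrite -ltrBrDr.
Qed.

HB.instance Definition _ := Nbhs_isNbhsTopological.Build (kset X)
  kset_nbhs_filter kset_nbhs_singleton kset_nbhs_nbhs.

End upper_hausdorff.

Lemma powR_lipschitz (R : realType) (p D : R) : 1 <= p -> 0 <= D ->
  exists2 L : R, 0 <= L & forall s t, 0 <= s -> 0 <= t -> t <= D ->
    t `^ p <= s `^ p + L * `|t - s|.
Proof.
move=> p1 D0; pose k := (Num.truncn p).+1; have p0 : 0 <= p by lra.
exists (k%:R * D `^ (p - 1)); first by rewrite mulr_ge0 ?powR_ge0.
move=> s t s0 t0 tD; have [ts|st] := leP t s.
  apply: (@le_trans _ _ (s `^ p)); first exact: ge0_ler_powR.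
  by rewrite lerDl !mulr_ge0 ?powR_ge0.
have t_gt0 : 0 < t by lra.
have [-> /= | sn0] := eqVneq s 0.
  rewrite powR0 ?add0r; last by rewrite gt_eqF//; lra.
  rewrite subr0 ger0_norm// -mulr_powRB1//; last lra.
  rewrite [leRHS]mulrC ler_wpM2l//.
  apply: (@le_trans _ _ (D `^ (p - 1))); first by apply: ge0_ler_powR => //; lra.
  by rewrite ler_peMl ?powR_ge0// /k ler1n.
have s_gt0 : 0 < s by rewrite lt_neqAle eq_sym sn0.
pose u := s / t.
have u01 : 0 < u <= 1 by rewrite divr_gt0//= ler_pdivrMr// mul1r ltW.
have sE : s = t * u by rewrite /u mulrC divfK// gt_eqF.
have u_ge : 1 - k%:R * (1 - u) <= u `^ p.
  apply: (@le_trans _ _ (u ^+ k)); last first.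
    by rewrite -powR_mulrn ?ger_powR//; [apply/ltW; rewrite /k truncnS_gt|lra].
  elim: k => [|n ih]; first by rewrite expr0 mul0r subr0.
  rewrite exprS -natr1.
  have : u * (1 - n%:R * (1 - u)) <= u * u ^+ n by rewrite ler_pM2l//; lra.
  apply: le_trans; have n0 : 0 <= n%:R :> R by [].
  rewrite -subr_ge0 (_ : _ - _ = n%:R * (1 - u) ^+ 2); last by ring.
  by rewrite mulr_ge0// sqr_ge0.
have tp : t `^ p - s `^ p <= t `^ (p - 1) * (k%:R * (t - s)).
  rewrite [in s `^ p]sE powRM//; last lra.
  rewrite -(mulr_powRB1 t0); last lra.
  have -> : t * t `^ (p - 1) - t * t `^ (p - 1) * u `^ p =
    t `^ (p - 1) * (t * (1 - u `^ p)) by ring.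
  rewrite ler_wpM2l ?powR_ge0//.
  have -> : k%:R * (t - s) = t * (k%:R * (1 - u)) by rewrite sE; ring.
  by rewrite ler_pM2l//; lra.
rewrite -lerBlDl (le_trans tp)// ger0_norm; last lra.
rewrite -mulrA mulrCA ler_wpM2l//.
by rewrite ler_wpM2r//; [lra|apply: ge0_ler_powR => //; rewrite ?nnegrE; lra].
Qed.

Section frechet_mean.
Context {R : realType} {X : pmetricType R}.
Implicit Types (p : R) (nu : probability (borel X) R).

Definition frechet_fun p nu (x : X) : \bar R :=
  (\int[nu]_y ((mdist x y) `^ p)%:E)%E.

Definition frechet_argmin p nu : set X :=
  [set x | forall x', (frechet_fun p nu x <= frechet_fun p nu x')%E].


Lemma measurable_mdist x : measurable_fun [set: borel X] (mdist x : borel X -> R).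
Proof.
apply: (measurability _ (RGenOpens.measurableE R)).
move=> _ [_ [a [b ->]] <-]; rewrite setTI.
apply: sub_sigma_algebra.
apply: (@open_comp X R^o (mdist x)); last exact: interval_open.
by move=> y _; exact: mdist_continuousr.
Qed.

Lemma measurable_mdist_powR p x :
  measurable_fun [set: borel X] (fun y => ((mdist x y) `^ p)%:E).
Proof.
apply/measurable_EFinP.
exact: (measurableT_comp (measurable_powR p) (@measurable_mdist x)).
Qed.

Lemma frechet_fun_ge0 p nu x : (0 <= frechet_fun p nu x)%E.
Proof. by apply: integral_ge0 => y _; rewrite /= lee_fin powR_ge0. Qed.

Section compact_space.
Context (cX : compact [set: X]).

Lemma frechet_fun_fin p nu x : 1 <= p -> frechet_fun p nu x \is a fin_num.
Proof.
move=> p1; rewrite ge0_fin_numE ?frechet_fun_ge0//.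
have [M MX] := mdist_bounded x cX.
have M0 : 0 <= M by apply: le_trans (MX x I); exact: mdist_ge0.
apply: (@le_lt_trans _ _ (\int[nu]_(y in setT) (cst (M `^ p)%:E) y)%E); last first.
  by rewrite integral_cst//= probability_setT mule1 ltry.
apply: ge0_le_integral => //.
- by move=> y _; rewrite /= lee_fin powR_ge0.
- exact: measurable_mdist_powR.
- move=> y _; rewrite lee_fin ge0_ler_powR ?nnegrE ?mdist_ge0 ?MX//; lra.
Qed.

Lemma frechet_fun_lipschitz p nu : 1 <= p -> exists2 L : R, 0 <= L &
  forall x x', (frechet_fun p nu x <= frechet_fun p nu x' + (L * mdist x x')%:E)%E.
Proof.
move=> p1; have [M MX] := mdist_bounded (point : X) cX.
have M0 : 0 <= M by apply: le_trans (MX point I); exact: mdist_ge0.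
have [|L L0 LM] := @powR_lipschitz R p (M + M) p1; first lra.
exists L => // x x'.
have c0 : 0 <= L * mdist x x' by rewrite mulr_ge0// mdist_ge0.
have -> : (L * mdist x x')%:E =
    (\int[nu]_(y in setT) (cst (L * mdist x x')%:E) y)%E.
  by rewrite integral_cst//= probability_setT mule1.
rewrite -ge0_integralD//; first last.
- exact: measurable_mdist_powR.
- by move=> y _; rewrite /= lee_fin powR_ge0.
apply: ge0_le_integral => //.
- by move=> y _; rewrite /= lee_fin powR_ge0.
- exact: measurable_mdist_powR.
- by apply: emeasurable_funD => //; exact: measurable_mdist_powR.
move=> y _; rewrite /= -EFinD lee_fin.
apply: le_trans (LM (mdist x' y) _ (mdist_ge0 _ _) (mdist_ge0 _ _) _) _.
  have := metric_triangle x point y; have := MX x I; have := MX y I.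
  rewrite (metric_sym x point); lra.
rewrite lerD2l ler_wpM2l//.
have h1 := metric_triangle x x' y; have h2 := metric_triangle x' x y.
rewrite (metric_sym x' x) in h2.
by rewrite ler_norml; apply/andP; split; lra.
Qed.

Let ffun p nu x : R^o := fine (frechet_fun p nu x).

Let ffun_continuous p nu : 1 <= p -> continuous (ffun p nu).
Proof.
move=> p1; have [L L0 LP] := frechet_fun_lipschitz nu p1.
have {}LP x x' : ffun p nu x <= ffun p nu x' + L * mdist x x'.
  rewrite -lee_fin EFinD /ffun !fineK//; exact: frechet_fun_fin.
move=> x; apply/cvgrPdist_lt => e e0; near=> z.
have xz : mdist x z < e / (L + 1).
  have : ball x (e / (L + 1)) z.
    by near: z; apply: nbhsx_ballx; rewrite divr_gt0// ltr_wpDl.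
  by rewrite ballEmdist.
have {}xz : L * mdist x z < e.
  rewrite ltr_pdivlMr ?ltr_wpDl// in xz.
  apply: le_lt_trans xz; have := mdist_ge0 x z; nra.
have h1 := LP x z; have h2 := LP z x; rewrite (metric_sym z x) in h2.
by rewrite ltr_norml; apply/andP; split; lra.
Unshelve. all: by end_near. Qed.

Lemma frechet_argmin_neq0 p nu : 1 <= p -> frechet_argmin p nu !=set0.
Proof.
move=> p1.
have [||c _ cmin] := @compact_EVT_min X R (ffun p nu) [set: X] _ cX.
- by exists point.
- exact/continuous_subspaceT/ffun_continuous.
exists c => x /=; have := cmin x (mem_set I).
by rewrite -lee_fin /ffun !fineK// frechet_fun_fin.
Qed.

Lemma frechet_argmin_compact p nu : 1 <= p -> compact (frechet_argmin p nu).
Proof.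
move=> p1; apply: subclosed_compact cX _ => //.
have -> : frechet_argmin p nu = \bigcap_x (ffun p nu @^-1` [set r | r <= ffun p nu x]).
  apply/seteqP; split => [y ymin x _ /=|y ymin x].
    by rewrite -lee_fin /ffun !fineK ?frechet_fun_fin.
  by have := ymin x I; rewrite /= -lee_fin /ffun !fineK ?frechet_fun_fin.
apply: closed_bigI => x _; apply: closed_comp; last exact: closed_le.
by move=> y _; exact: ffun_continuous.
Qed.

Definition frechet_mean p (p1 : 1 <= p) nu : kset X :=
  KSet (@frechet_argmin_neq0 p nu p1) (@frechet_argmin_compact p nu p1).

End compact_space.
End frechet_mean.

Section relative_entropy.
Context {d} {T : measurableType d} {R : realType}.
Local Open Scope ereal_scope.
Local Open Scope charge_scope.

(* lne sends 0 (and every negative value) to -oo; the density is positive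
   nu-almost everywhere. *)
Definition relative_entropy (nu mu : probability T R) : \bar R :=
  if `[< nu `<< mu >] then
    \int[nu]_x lne (('d (charge_of_finite_measure nu) '/d mu) x)
  else +oo.

End relative_entropy.

Definition rate (R : realType) (X : pmetricType R) (cX : compact [set: X])
    (p : R) (p1 : 1 <= p) (mu : probability (borel X) R) (C : kset X) : \bar R :=
  ereal_inf [set relative_entropy nu mu | nu in
    [set nu : probability (borel X) R | C `<=` frechet_mean cX p1 nu]].

Section empirical_measure.
Context {d} {T : measurableType d} {R : realType}.
Variables (n : nat) (y : nat -> T).

(* The sample has n + 1 points y 0, ..., y n, so that it is never empty. *)
Definition empirical : set T -> \bar R :=
  mscale (n.+1%:R^-1 : R)%:nng (msum (fun i => \d_(y i)) n.+1).

HB.instance Definition _ := Measure.on empirical.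

Let empirical_setT : empirical setT = 1%E.
Proof.
rewrite /empirical /mscale/= /msum.
under eq_bigr do rewrite /= diracT.
by rewrite sumEFin sumr_const card_ord -EFinM mulVf.
Qed.

HB.instance Definition _ :=
  Measure_isProbability.Build _ _ _ empirical empirical_setT.

End empirical_measure.

(* Y 0, Y 1, ... stand for Y_1, Y_2, ... *)
Section iid.
Context {d d'} {Omega : measurableType d} {T : measurableType d'} {R : realType}.
Variables (P : probability Omega R) (Y : nat -> {RV P >-> T}).

Definition mutually_independent :=
  forall (J : {fset nat}) (B : nat -> set T),
  (forall i, i \in J -> measurable (B i)) ->
  P (\bigcap_(i in [set` J]) Y i @^-1` B i) =
  (\prod_(i <- J) P (Y i @^-1` B i))%E.

Definition iid (mu : probability T R) := mutually_independent /\
  forall i B, measurable B -> distribution P (Y i) B = mu B.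

End iid.

Arguments mutually_independent {d d' Omega T R} P Y.
Arguments iid {d d' Omega T R} P Y mu.

(* Main.v *)
(* Write [phi nu x] for the integral of [d (x, y) ^ p] over [nu], whose minimizers
   form the Frechet mean of [nu].  All [phi nu] are bounded and share one Lipschitz
   constant, so they are relatively compact for uniform convergence, which finite
   nets control, and [nu |-> argmin (phi nu)] is upper semicontinuous in [phi nu].

   Lower semicontinuity of the rate: if [phi nu_k] converges uniformly to a function
   and the entropies [H(nu_k | mu)] are at most [a] in the limit, almost minimal
   densities in the convex sets [{f | |phi (f mu) - lim| <= 1/k}] are Cauchy in [L1]
   by strict convexity of [t ln t], so the limit function is [phi nu] for some [nu]
   with [H(nu | mu) <= a].  This gives compactness of the sublevel sets.

   Upper bound: for any event [B], the conditional expectation given [B] of the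
   empirical measure has relative entropy at most [- ln P(B) / (n + 1)] (Csiszar).
   Taking for [B] the event that [phi] of the empirical measure lies in a convex
   neighborhood defined by finitely many points, and covering the relevant functions
   by finitely many such neighborhoods, yields [P <= N exp (- a (n + 1))] for every
   [n] as soon as no measure of entropy at most [a] has its Frechet mean in the
   complement of a given open set. *)
From HB Require Import structures.
Require Import Defs.
From mathcomp Require Import all_boot all_order all_algebra finmap.
From mathcomp Require Import all_classical all_reals all_analysis.
From mathcomp Require Import measurable_realfun ring lra.

Import Order.TTheory GRing.Theory Num.Theory.
Import numFieldNormedType.Exports.

Local Open Scope classical_set_scope.
Local Open Scope ring_scope.

Set Implicit Arguments.
Unset Strict Implicit.
Unset Printing Implicit Defensive.

(** * Convexity and continuity of [t ln t - t + 1] *)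

Section entropy_fun.
Context {R : realType}.
Implicit Types s t e : R.

(** The terms [- t + 1] integrate to zero for a density against a probability measure, so the
    integral is still the relative entropy, now of a nonnegative integrand to which Fatou and
    additivity apply directly. *)
Definition entropy_fun t : R := t * ln t - t + 1.

Lemma entropy_fun0 : entropy_fun 0 = 1.
Proof. by rewrite /entropy_fun ln0// mul0r subrr add0r. Qed.

Lemma ln_ge t : 0 < t -> 1 - t^-1 <= ln t.
Proof.
move=> t0; have := @le_ln1Dx R (t^-1 - 1).
have -> : 1 + (t^-1 - 1) = t^-1 by ring.
rewrite lnV ?posrE// lerNl opprB => -> //.
by rewrite -subr_gt0 opprK subrK invr_gt0.
Qed.

Lemma mul_ln_ge t : 0 <= t -> t - 1 <= t * ln t.
Proof.
rewrite le_eqVlt => /predU1P[<-|t0]; first by rewrite mul0r; lra.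
have := ler_wpM2l (ltW t0) (ln_ge t0).
by rewrite mulrBr mulr1 divff ?gt_eqF.
Qed.

Lemma entropy_fun_ge0 t : 0 <= t -> 0 <= entropy_fun t.
Proof. by move=> /mul_ln_ge; rewrite /entropy_fun; lra. Qed.

(** This is [ln_ge] at the ratio of the square roots of [s] and [m], multiplied by [2 s]. *)
Lemma mul_ln_ratio_ge s m : 0 <= s -> 0 < m ->
  2 * (s - Num.sqrt s * Num.sqrt m) <= s * ln s - s * ln m.
Proof.
move=> s0 m0; have [->|s_neq0] := eqVneq s 0.
  by rewrite sqrtr0 !mul0r; lra.
have {}s0 : 0 < s by rewrite lt_neqAle eq_sym s_neq0.
have rs := sqr_sqrtr (ltW s0); have rm := sqr_sqrtr (ltW m0).
have a0 : 0 < Num.sqrt s by rewrite sqrtr_gt0.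
have b0 : 0 < Num.sqrt m by rewrite sqrtr_gt0.
set a : R := Num.sqrt s in a0 rs *; set b : R := Num.sqrt m in b0 rm *.
clearbody a b; rewrite -rs -rm {s_neq0 s0 m0 rs rm s m}.
have /ln_ge : 0 < a / b by rewrite divr_gt0.
rewrite lnM ?posrE ?invr_gt0// lnV ?posrE// !lnXn// invf_div => h.
have : a ^+ 2 * (1 - b / a) <= a ^+ 2 * (ln a - ln b).
  by rewrite ler_pM2l// exprn_gt0.
have -> : a ^+ 2 * (1 - b / a) = a ^+ 2 - a * b by field; rewrite gt_eqF.
rewrite !mulr2n; set l := ln a - ln b.
have -> : a ^+ 2 * (ln a + ln a) - a ^+ 2 * (ln b + ln b) = 2 * (a ^+ 2 * l).
  by rewrite /l; ring.
by move=> h'; rewrite ler_pM2l.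
Qed.

(** Quantitative strict convexity: add [mul_ln_ratio_ge] for [s] and for [t] at their midpoint [m],
    and bound [(sqrt s + sqrt t) sqrt m] by expanding the square of [sqrt s + sqrt t - 2 sqrt m]. *)
Lemma entropy_fun_midpoint s t : 0 <= s -> 0 <= t ->
  (Num.sqrt s - Num.sqrt t) ^+ 2 / 4 <=
  (entropy_fun s + entropy_fun t) / 2 - entropy_fun ((s + t) / 2).
Proof.
move=> s0 t0; have [st|st] := eqVneq (s + t) 0.
  have -> : s = 0 by lra.
  have -> : t = 0 by lra.
  by rewrite !(addr0, mul0r, entropy_fun0, subrr, expr0n)/=; lra.
have m0 : 0 < (s + t) / 2 by lra.
have hs := mul_ln_ratio_ge s0 m0; have ht := mul_ln_ratio_ge t0 m0.
have rs := sqr_sqrtr s0; have rt := sqr_sqrtr t0; have rm := sqr_sqrtr (ltW m0).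
have : 0 <= (Num.sqrt s + Num.sqrt t - 2 * Num.sqrt ((s + t) / 2)) ^+ 2.
  exact: sqr_ge0.
rewrite /entropy_fun; move: hs ht.
set l := ln (_ / 2); set ls := s * ln s; set lt := t * ln t.
move: rs rt rm.
move: (Num.sqrt s) (Num.sqrt t) (Num.sqrt ((s + t) / 2)) => a b c.
move=> rs rt rm h1 h2 h3; nra.
Qed.

(** As [s - t = (sqrt s - sqrt t) (sqrt s + sqrt t)], Young's inequality with weight [e] leaves a
    multiple of the midpoint gap over [e] and a multiple of [e (s + t)]. The midpoint term stays on
    the left so that only nonnegative terms are integrated later. *)
Lemma entropy_fun_dist s t e : 0 <= s -> 0 <= t -> 0 < e ->
  `|s - t| + 2 / e * entropy_fun ((s + t) / 2) <=
  (entropy_fun s + entropy_fun t) / e + e * (s + t).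
Proof.
move=> s0 t0 e0; have := entropy_fun_midpoint s0 t0.
set g := entropy_fun s; set g' := entropy_fun t; set m := entropy_fun _.
have rs := sqr_sqrtr s0; have rt := sqr_sqrtr t0.
have a0 := sqrtr_ge0 s; have b0 := sqrtr_ge0 t.
set a : R := Num.sqrt s in a0 rs *; set b : R := Num.sqrt t in b0 rt *.
clearbody a b => h.
have gap : (a - b) ^+ 2 / (2 * e) <= (g + g') / e - 2 / e * m.
  have -> : (a - b) ^+ 2 / (2 * e) = (a - b) ^+ 2 / 4 * (2 / e).
    by field; rewrite gt_eqF.
  have -> : (g + g') / e - 2 / e * m = ((g + g') / 2 - m) * (2 / e).
    by field; rewrite gt_eqF.
  by rewrite ler_wpM2r// divr_ge0// ltW.
suff : `|s - t| <= (a - b) ^+ 2 / (2 * e) + e * (s + t) by lra.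
have -> : s - t = (a - b) * (a + b) by rewrite -rs -rt; ring.
rewrite normrM (ger0_norm (_ : 0 <= a + b)); last lra.
rewrite -(real_normK (num_real (a - b))).
set d := `|a - b|; have d0 : 0 <= d := normr_ge0 _.
have : 0 <= (d - e * (a + b)) ^+ 2 / (2 * e).
  by rewrite divr_ge0 ?sqr_ge0//; lra.
have -> : (d - e * (a + b)) ^+ 2 / (2 * e) =
   d ^+ 2 / (2 * e) - d * (a + b) + e / 2 * (a + b) ^+ 2.
  by field; rewrite gt_eqF.
have : (a + b) ^+ 2 <= 2 * (s + t) by have := sqr_ge0 (a - b); rewrite -rs -rt; lra.
move=> h1; have : e / 2 * (a + b) ^+ 2 <= e / 2 * (2 * (s + t)).
  by rewrite ler_wpM2l//; lra.
lra.
Qed.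

Lemma mul_ln_ge_sqrt t : 0 <= t -> - (2 * Num.sqrt t) <= t * ln t.
Proof.
move=> t0; have := mul_ln_ratio_ge t0 ltr01.
by rewrite ln1 mulr0 subr0 sqrtr1 mulr1; lra.
Qed.

Lemma entropy_fun_cvg (u : R ^nat) l : (forall n, 0 <= u n) ->
  u @ \oo --> l -> (entropy_fun \o u) @ \oo --> entropy_fun l.
Proof.
move=> u0 ul; have l0 : 0 <= l.
  by apply: (cvgr_to_ge ul); exact: nearW.
suff h : (fun n => u n * ln (u n)) @ \oo --> l * ln l.
  by apply: cvgD; [exact: cvgB|exact: cvg_cst].
move: l0; rewrite le_eqVlt => /predU1P[l_eq0|l_gt0]; last first.
  apply: cvgM => //.
  by apply: continuous_cvg => //; exact: continuous_ln.
(* At the limit 0, where [ln] is not continuous, [u ln u] is squeezed between [- 2 sqrt u] and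
   [u (u - 1)]. *)
move: ul; rewrite -l_eq0 mul0r => ul.
have su : (fun n => - (2 * Num.sqrt (u n))) @ \oo --> (0 : R).
  rewrite -[X in _ --> X](_ : - (2 * Num.sqrt 0) = 0 :> R); last first.
    by rewrite sqrtr0 mulr0 oppr0.
  apply: cvgN; apply: cvgM; first exact: cvg_cst.
  by apply: continuous_cvg => //; exact: sqrt_continuous.
have hu : (fun n => u n * (u n - 1)) @ \oo --> (0 : R).
  rewrite -[X in _ --> X](_ : 0 * (0 - 1) = 0 :> R); last by rewrite mul0r.
  by apply: cvgM => //; apply: cvgB => //; exact: cvg_cst.
apply: (squeeze_cvgr _ su hu).
near=> n; rewrite mul_ln_ge_sqrt//=.
have := u0 n; rewrite le_eqVlt => /predU1P[<-|un0]; first by rewrite !mul0r.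
rewrite ler_pM2l//; have := @le_ln1Dx R (u n - 1).
by rewrite (_ : 1 + (u n - 1) = u n); [apply; lra|ring].
Unshelve. all: by end_near. Qed.

End entropy_fun.

(** * Measures given by a density *)

Section density_measure.
Context {d} {T : measurableType d} {R : realType}.
Variable mu : {measure set T -> \bar R}.
Variables (f : T -> R) (mf : measurable_fun [set: T] f) (f0 : forall x, 0 <= f x).

(** The [let] makes the constant carry [mf] and [f0], so that the measure structure can be read off
    the term. *)
Definition density_measure (A : set T) : \bar R :=
  let _ := (mf, f0) in (\int[mu]_(x in A) (f x)%:E)%E.

Let mEf : measurable_fun [set: T] (EFin \o f).
Proof. exact/measurable_EFinP. Qed.

Let density0 : density_measure set0 = 0%E.
Proof. exact: integral_set0. Qed.

Let density_ge0 A : (0 <= density_measure A)%E.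
Proof. by apply: integral_ge0 => x _; rewrite lee_fin. Qed.

Let density_sigma_additive : semi_sigma_additive density_measure.
Proof.
by apply: (@semi_sigma_additive_nng_induced _ _ _ mu (EFin \o f)) => // x;
  rewrite lee_fin.
Qed.

HB.instance Definition _ := isMeasure.Build _ _ _ density_measure
  density0 density_ge0 density_sigma_additive.

Import HBNNSimple.

(** Monotone convergence along simple functions reduces to indicators, where the identity is the
    definition of [density_measure]. *)
Lemma ge0_integral_density (g : T -> \bar R) :
  measurable_fun [set: T] g -> (forall x, 0 <= g x)%E ->
  (\int[density_measure]_x g x = \int[mu]_x (g x * (f x)%:E))%E.
Proof.
move=> mg g0; pose h := nnsfun_approx measurableT mg.
have gE x : g x = limn (EFin \o h ^~ x).
  by apply/esym/cvg_lim => //; apply: cvg_nnsfun_approx.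
have gfE x : (g x * (f x)%:E)%E = limn (fun n => (h n x)%:E * (f x)%:E)%E.
  apply/esym/cvg_lim => //; apply: cvgeZr => //.
  by apply: cvg_nnsfun_approx.
under [RHS]eq_integral do rewrite gfE.
under [LHS]eq_integral do rewrite gE.
rewrite monotone_convergence//; last 3 first.
- by move=> n; exact/measurable_EFinP/measurable_funP.
- by move=> n x _; rewrite lee_fin.
- by move=> x _ a b ab; rewrite lee_fin; exact/lefP/nd_nnsfun_approx.
rewrite monotone_convergence//; last 3 first.
- by move=> n; apply: emeasurable_funM => //; exact/measurable_EFinP/measurable_funP.
- by move=> n x _; rewrite mule_ge0// lee_fin.
- move=> x _ a b ab; rewrite lee_wpmul2r ?lee_fin//.
  exact/lefP/nd_nnsfun_approx.
congr (limn _); apply/funext => n.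
transitivity (\int[density_measure]_x
   (\sum_(y \in range (h n)) (y * \1_(h n @^-1` [set y]) x)%:E))%E.
  by apply: eq_integral => t tE; rewrite /= fimfunE -fsumEFin.
have indich r : measurable_fun [set: T] (fun x => (r * \1_(h n @^-1` [set r]) x)%:E).
  by apply/measurable_EFinP/measurable_funM.
rewrite ge0_integral_fsum//; last by move=> y Ey _; exact: nnfun_muleindic_ge0.
transitivity (\int[mu]_x (\sum_(y \in range (h n))
    (y * \1_(h n @^-1` [set y]) x)%:E * (f x)%:E))%E; last first.
  apply: eq_integral => x xE.
  rewrite -ge0_mule_fsuml => [|y]; last exact: nnfun_muleindic_ge0.
  by rewrite fsumEFin // -(fimfunE _ x).
rewrite ge0_integral_fsum//; last 2 first.
- by move=> y; apply: emeasurable_funM.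
- move=> m y _; apply: mule_ge0; last by rewrite lee_fin.
  exact: nnfun_muleindic_ge0.
apply: eq_fsbigr => r; rewrite inE => -[t _ rE].
have r0 : (0 <= r%:E)%E by rewrite -rE lee_fin.
under eq_integral do rewrite EFinM.
rewrite integralZl_indic_nnsfun// integral_indic// setIT.
under [RHS]eq_integral do rewrite EFinM -muleA.
rewrite ge0_integralZl//; last 2 first.
- by apply: emeasurable_funM => //; exact/measurable_EFinP.
- by move=> x _; rewrite mule_ge0 ?lee_fin.
congr (_ * _)%E; rewrite /= /density_measure/= [LHS]integral_mkcond.
by apply: eq_integral => x _; rewrite epatch_indic/= muleC.
Qed.

Hypothesis f1 : (\int[mu]_x (f x)%:E = 1)%E.

Definition density_probability (A : set T) : \bar R :=
  let _ := f1 in density_measure A.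

HB.instance Definition _ := isMeasure.Build _ _ _ density_probability
  density0 density_ge0 density_sigma_additive.

Let density_setT : density_probability [set: T] = 1%E.
Proof. exact: f1. Qed.

HB.instance Definition _ :=
  Measure_isProbability.Build _ _ _ density_probability density_setT.

End density_measure.

(** * Relative entropy as an integral of the density *)

Section relative_entropy_density.
Context {d} {T : measurableType d} {R : realType}.
Variables mu : probability T R.
Implicit Types (f g : T -> R) (nu : probability T R).

Definition density f := [/\ measurable_fun [set: T] f, forall x, 0 <= f x &
  (\int[mu]_x (f x)%:E = 1)%E].

Definition has_density nu f := forall A, measurable A ->
  nu A = (\int[mu]_(x in A) (f x)%:E)%E.

Definition density_entropy f := (\int[mu]_x (entropy_fun (f x))%:E)%E.

Lemma density_entropy_ge0 f : density f -> (0 <= density_entropy f)%E.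
Proof.
by move=> [_ f0 _]; apply: integral_ge0 => x _; rewrite lee_fin entropy_fun_ge0.
Qed.

Lemma measurable_entropy_fun f : measurable_fun [set: T] f ->
  measurable_fun [set: T] (fun x => entropy_fun (f x)).
Proof.
move=> mf; apply: measurable_funD => //; apply: measurable_funB => //.
by apply: measurable_funM => //; exact: (measurableT_comp (@measurable_ln R)).
Qed.

Lemma has_density_density_measure nu f : density f -> has_density nu f ->
  forall (g : T -> \bar R), measurable_fun [set: T] g -> (forall x, 0 <= g x)%E ->
  (\int[nu]_x g x = \int[mu]_x (g x * (f x)%:E))%E.
Proof.
move=> [mf f0 f1] nuf g mg g0.
rewrite -(ge0_integral_density mu mf f0 mg g0).
by apply: eq_measure_integral => A mA _; exact: nuf.
Qed.

Lemma has_densityW nu f : measurable_fun [set: T] f -> (forall x, 0 <= f x) ->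
  has_density nu f -> density f.
Proof. by move=> mf f0 nuf; split=> //; rewrite -nuf ?probability_setT. Qed.

Lemma density_has_density f : density f -> exists nu, has_density nu f.
Proof.
move=> [mf f0 f1].
by exists (density_probability mf f0 f1).
Qed.

Lemma has_density_dominates nu f : measurable_fun [set: T] f ->
  has_density nu f -> nu `<< mu.
Proof.
move=> mf nuf; apply/null_content_dominatesP => A mA A0; rewrite nuf//.
by apply: null_set_integral => //; apply: measurable_funTS; exact/measurable_EFinP.
Qed.

Lemma dominates_has_density nu : nu `<< mu -> exists2 f, density f & has_density nu f.
Proof.
move=> numu; pose g := Radon_Nikodym_SigmaFinite.f nu mu.
have gfin x : g x \is a fin_num by exact: Radon_Nikodym_SigmaFinite.f_fin_num.
have gE : EFin \o (fine \o g) = g by apply/funext => x /=; rewrite fineK.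
have nug : has_density nu (fine \o g).
  move=> A mA; rewrite (Radon_Nikodym_SigmaFinite.f_integral numu mA).
  by apply: eq_integral => x _; rewrite /= fineK.
exists (fine \o g) => //; apply: has_densityW nug; last first.
  by move=> x; rewrite /= fine_ge0// Radon_Nikodym_SigmaFinite.f_ge0.
apply/measurable_EFinP; rewrite gE; apply: measurable_int.
exact: Radon_Nikodym_SigmaFinite.f_integrable.
Qed.

Lemma measurable_lne f : measurable_fun [set: T] f ->
  measurable_fun [set: T] (fun x => lne (f x)%:E).
Proof.
move=> mf; rewrite (_ : (fun _ => _) =
    (fun x => if (f x <= 0)%R then -oo%E else (ln (f x))%:E)).
  apply: measurable_fun_ifT => //.
    exact: measurable_fun_ler.
  by apply/measurable_EFinP; exact: (measurableT_comp (@measurable_ln R)).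
apply/funext => x; case: ifPn => [fx0|]; first by rewrite le0_lneNy.
by rewrite -ltNge => fx0; rewrite lne_EFin.
Qed.

(** The derivative is only determined [mu]-almost everywhere; domination carries its equality with
    [f] over to [nu]-almost everywhere. *)
Lemma relative_entropy_lne nu f : density f -> has_density nu f ->
  (relative_entropy nu mu = \int[nu]_x lne (f x)%:E)%E.
Proof.
move=> [mf f0 f1] nuf; have numu := has_density_dominates mf nuf.
rewrite /relative_entropy asboolT//.
set g := Radon_Nikodym _ _.
have gE : EFin \o (fine \o g) = g.
  by apply/funext => x /=; rewrite fineK// Radon_Nikodym_fin_num.
have mg : measurable_fun [set: T] (fine \o g).
  apply/measurable_EFinP; rewrite gE.
  exact: measurable_int (Radon_Nikodym_integrable _).
apply: ae_eq_integral => //.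
- rewrite -gE; exact: measurable_lne.
- exact: measurable_lne.
have fg : ae_eq mu [set: T] g (EFin \o f).
  apply: integral_ae_eq => //.
  - exact: Radon_Nikodym_integrable.
  - exact/measurable_EFinP.
  - by move=> A _ mA; rewrite -Radon_Nikodym_integral//; exact: nuf.
have := null_dominates_ae_eq measurableT numu fg.
by apply: filterS => x /= h /h ->.
Qed.

Let lp t : \bar R := maxe (lne t%:E) 0%E.
Let lm t : \bar R := maxe (- lne t%:E)%E 0%E.

Let lm_le1 (t : R) : 0 <= t -> (lm t * t%:E <= 1)%E.
Proof.
rewrite le_eqVlt => /predU1P[<-|t0]; first by rewrite mule0 lee01.
rewrite /lm lne_EFin// -EFinN -EFin_max -EFinM lee_fin.
have := mul_ln_ge (ltW t0).
by case: (leP (- ln t) 0) => h; rewrite ?(max_r _ h) ?mul0r//; nra.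
Qed.

(** The identity [entropy_fun t + t = t ln t + 1] written without subtraction, so that it can be
    integrated in the extended reals. *)
Let lp_lm (t : R) : 0 <= t ->
  ((entropy_fun t)%:E + t%:E + lm t * t%:E = lp t * t%:E + 1)%E.
Proof.
rewrite le_eqVlt => /predU1P[<-|t0].
  by rewrite !mule0 entropy_fun0 add0e !adde0.
rewrite /lp /lm lne_EFin// -EFinN -!EFin_max -!EFinM -!EFinD; congr EFin.
rewrite /entropy_fun.
have [l0|l0] := leP 0 (ln t).
  by rewrite max_r ?oppr_le0//; ring.
by rewrite max_l ?oppr_ge0 ?ltW//; ring.
Qed.

Lemma relative_entropy_posneg nu f : density f -> has_density nu f ->
  (relative_entropy nu mu = \int[nu]_x maxe (lne (f x)%:E) 0
                          - \int[nu]_x maxe (- lne (f x)%:E) 0)%E.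
Proof.
move=> df nuf; rewrite (relative_entropy_lne df nuf) integralE; congr (_ - _)%E.
  by apply: eq_integral => x _; rewrite funeposE.
by apply: eq_integral => x _; rewrite funenegE.
Qed.

Lemma integral_lne_neg nu f : density f -> has_density nu f ->
  (\int[nu]_x maxe (- lne (f x)%:E) 0)%E \is a fin_num.
Proof.
move=> df nuf; have [mf f0 f1] := df.
have mn : measurable_fun [set: T] (fun x => lm (f x)).
  by apply: measurable_maxe => //; apply: measurableT_comp => //; exact: measurable_lne.
rewrite ge0_fin_numE; last by apply: integral_ge0 => x _; rewrite le_max lexx orbT.
rewrite (has_density_density_measure df nuf)//; last first.
  by move=> x; rewrite le_max lexx orbT.
apply: (@le_lt_trans _ _ (\int[mu]_(x in [set: T]) (cst 1 x))%E); last first.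
  by rewrite integral_cst//= mul1e probability_setT ltry.
apply: ge0_le_integral => //.
- by move=> x _; rewrite mule_ge0// ?lee_fin// le_max lexx orbT.
- by apply: emeasurable_funM => //; exact/measurable_EFinP.
- by move=> x _; exact: lm_le1.
Qed.

(** Integrate [lp_lm] and cancel the negative part, which is finite; an infinite positive part then
    matches an infinite [density_entropy]. *)
Lemma relative_entropyE nu f : density f -> has_density nu f ->
  relative_entropy nu mu = density_entropy f.
Proof.
move=> df nuf; have [mf f0 f1] := df.
rewrite (relative_entropy_posneg df nuf).
have nfin := integral_lne_neg df nuf.
have mEf : measurable_fun [set: T] (EFin \o f) by exact/measurable_EFinP.
have ml : measurable_fun [set: T] (fun x => lne (f x)%:E) by exact: measurable_lne.
have mn : measurable_fun [set: T] (fun x => lm (f x)).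
  by apply: measurable_maxe => //; apply: measurableT_comp.
have mp : measurable_fun [set: T] (fun x => lp (f x)).
  exact: measurable_maxe.
have p0 t : (0 <= lp t)%E by rewrite le_max lexx orbT.
have n0 t : (0 <= lm t)%E by rewrite le_max lexx orbT.
have me : measurable_fun [set: T] (fun x => (entropy_fun (f x))%:E).
  by apply/measurable_EFinP; exact: measurable_entropy_fun.
have e0 x : (0 <= (entropy_fun (f x))%:E)%E by rewrite lee_fin entropy_fun_ge0.
have : (density_entropy f + 1 + \int[nu]_x lm (f x) = \int[nu]_x lp (f x) + 1)%E.
  rewrite !(has_density_density_measure df nuf)// -[in LHS]f1 /density_entropy.
  rewrite -ge0_integralD//; last by move=> x _; rewrite lee_fin.
  rewrite -ge0_integralD//; first last.
  - exact: emeasurable_funM.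
  - by move=> x _; rewrite mule_ge0// lee_fin.
  - exact: emeasurable_funD.
  - by move=> x _; rewrite adde_ge0// lee_fin.
  have -> : (1 = \int[mu]_(x in [set: T]) (cst 1 x))%E.
    by rewrite integral_cst//= mul1e probability_setT.
  rewrite -ge0_integralD//; first last.
  - exact: emeasurable_funM.
  - by move=> x _; rewrite mule_ge0// lee_fin.
  by apply: eq_integral => x _; exact: lp_lm.
rewrite -(fineK nfin) -/(lm _).
move: (\int[nu]_x lp (f x))%E (density_entropy f) => P E.
move: (fine _) => q.
by case: E => [e||]; case: P => [p||] //=; rewrite -?EFinD => // -[] h; congr EFin; lra.
Qed.

Lemma relative_entropy_ge0 nu : (0 <= relative_entropy nu mu)%E.
Proof.
have [numu|numu] := pselect (nu `<< mu); last by rewrite /relative_entropy asboolF.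
have [f df nuf] := dominates_has_density numu.
by rewrite (relative_entropyE df nuf) density_entropy_ge0.
Qed.

Lemma relative_entropy_lty nu : (relative_entropy nu mu < +oo)%E ->
  exists f, [/\ density f, has_density nu f &
    relative_entropy nu mu = density_entropy f].
Proof.
have [numu|numu] := pselect (nu `<< mu); last first.
  by rewrite /relative_entropy asboolF.
have [f df nuf] := dominates_has_density numu.
by exists f; split => //; exact: relative_entropyE.
Qed.

End relative_entropy_density.

(** * Limits of almost entropy-minimal densities *)

Section entropy_limit.
Context {d} {T : measurableType d} {R : realType}.
Variables mu : probability T R.
Implicit Types (f g : T -> R).

Definition L1dist f g : \bar R := (\int[mu]_x `|f x - g x|%:E)%E.

Lemma measurable_dist f g : measurable_fun [set: T] f ->
  measurable_fun [set: T] g ->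
  measurable_fun [set: T] (fun x => `|f x - g x|%:E).
Proof.
move=> mf mg; apply/measurable_EFinP.
by apply: measurableT_comp => //; exact: measurable_funB.
Qed.

Lemma measurable_midpoint f g : measurable_fun [set: T] f ->
  measurable_fun [set: T] g -> measurable_fun [set: T] (fun x => (f x + g x) / 2).
Proof. by move=> mf mg; apply: measurable_funM => //; exact: measurable_funD. Qed.

Lemma density_midpoint f g : density mu f -> density mu g ->
  density mu (fun x => (f x + g x) / 2).
Proof.
move=> [mf f0 f1] [mg g0 g1]; split; first exact: measurable_midpoint.
  by move=> x; have := f0 x; have := g0 x; lra.
under eq_integral do rewrite mulrC EFinM EFinD.
rewrite ge0_integralZl//.
- rewrite ge0_integralD//; try exact/measurable_EFinP; try by move=> x _; rewrite lee_fin.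
  by rewrite f1 g1 -EFinD -EFinM; congr EFin; lra.
- by apply: emeasurable_funD; exact/measurable_EFinP.
- by move=> x _; rewrite -EFinD lee_fin addr_ge0.
Qed.

(** Integrate [entropy_fun_dist]: the two entropies contribute at most [2 (I + c) / e], the midpoint
    takes away at least [2 (I - c) / e], and the total mass 2 gives [2 e]. *)
Lemma L1dist_entropy f g (e I c : R) : density mu f -> density mu g -> 0 < e ->
  (density_entropy mu f <= (I + c)%:E)%E -> (density_entropy mu g <= (I + c)%:E)%E ->
  ((I - c)%:E <= density_entropy mu (fun x => ((f x + g x) / 2)%R))%E ->
  (L1dist f g <= (4 * c / e + 2 * e)%:E)%E.
Proof.
move=> df dg e0 fI gI; have := density_midpoint df dg.
have [mf f0 f1] := df; have [mg g0 g1] := dg.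
set m := fun x => _ => dm mI; have [mm m0 m1] := dm.
have e2 : 0 <= 2 / e by rewrite divr_ge0// ltW.
have e1 : 0 <= e^-1 by rewrite invr_ge0 ltW.
have ment h : density mu h -> measurable_fun [set: T] (fun x => (entropy_fun (h x))%:E).
  by move=> [mh _ _]; apply/measurable_EFinP; exact: measurable_entropy_fun.
have ent0 h x : density mu h -> (0 <= (entropy_fun (h x))%:E)%E.
  by move=> [_ h0 _]; rewrite lee_fin entropy_fun_ge0.
have H : (L1dist f g + (2 / e)%:E * density_entropy mu m <=
    (e^-1)%:E * (density_entropy mu f + density_entropy mu g) + e%:E * (1 + 1))%E.
  rewrite -{1}f1 -{1}g1 /density_entropy /L1dist.
  rewrite -ge0_integralZl//; [|exact: ment|by move=> x _; exact: ent0].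
  rewrite -ge0_integralD//; first last.
  - by apply: emeasurable_funM => //; exact: ment.
  - by move=> x _; rewrite mule_ge0// ent0.
  - exact: measurable_dist.
  rewrite -ge0_integralD//; [|by move=> x _; exact: ent0|exact: ment
     |by move=> x _; exact: ent0|exact: ment].
  rewrite -ge0_integralZl//; [|by apply: emeasurable_funD; exact: ment
      |by move=> x _; apply: adde_ge0; exact: ent0].
  rewrite -ge0_integralD//; try exact/measurable_EFinP; try by move=> x _; rewrite lee_fin.
  rewrite -ge0_integralZl//; first last.
  - by rewrite lee_fin ltW.
  - by move=> x _; rewrite -EFinD lee_fin addr_ge0.
  - by apply: emeasurable_funD; exact/measurable_EFinP.
  rewrite -ge0_integralD//; first last.
  - by apply: emeasurable_funM => //; apply: emeasurable_funD; exact/measurable_EFinP.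
  - by move=> x _; rewrite -EFinD mule_ge0// lee_fin ?addr_ge0// ltW.
  - by apply: emeasurable_funM => //; apply: emeasurable_funD; exact: ment.
  - by move=> x _; rewrite mule_ge0// adde_ge0// ent0.
  apply: ge0_le_integral => //.
  - by move=> x _; rewrite adde_ge0// mule_ge0// ent0.
  - apply: emeasurable_funD; first exact: measurable_dist.
    by apply: emeasurable_funM => //; exact: ment.
  - apply: emeasurable_funD.
      by apply: emeasurable_funM => //; apply: emeasurable_funD; exact: ment.
    by apply: emeasurable_funM => //; apply: emeasurable_funD; exact/measurable_EFinP.
  move=> x _; have := entropy_fun_dist (f0 x) (g0 x) e0.
  by rewrite [X in _ <= X + _]mulrC -lee_fin.
have fF : density_entropy mu f \is a fin_num.
  by rewrite ge0_fin_numE ?density_entropy_ge0// (le_lt_trans fI)// ltry.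
have gF : density_entropy mu g \is a fin_num.
  by rewrite ge0_fin_numE ?density_entropy_ge0// (le_lt_trans gI)// ltry.
have LF : L1dist f g \is a fin_num.
  rewrite ge0_fin_numE; last by apply: integral_ge0.
  apply: (@le_lt_trans _ _ (L1dist f g + (2 / e)%:E * density_entropy mu m)%E).
    by rewrite leeDl// mule_ge0// density_entropy_ge0.
  by apply: (le_lt_trans H); rewrite -(fineK fF) -(fineK gF) -!EFinD -?EFinM -?EFinD ltry.
have {}H : (L1dist f g + (2 / e)%:E * (I - c)%:E <=
    (e^-1)%:E * (density_entropy mu f + density_entropy mu g) + e%:E * (1 + 1))%E.
  by apply: le_trans H; rewrite leeD2l// lee_pmul2l// lte_fin divr_gt0.
move: H fI gI; rewrite -(fineK fF) -(fineK gF) -(fineK LF) -!EFinD -?EFinM -?EFinD !lee_fin.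
move: (fine _) (fine _) (fine _) => a b l H fI gI.
have : e^-1 * (a + b) <= e^-1 * ((I + c) + (I + c)) by rewrite ler_wpM2l//; lra.
move: H; rewrite mulrAC.
move: (e^-1) => z; nra.
Qed.

(** The L1 increments are summable, so the sum [G] of [|F j - F j.+1|] is integrable. Off the null
    set where [G] is infinite, [F] converges by telescoping and is dominated by [F 0 + G]; dominated
    convergence gives the L1 limit and Fatou the entropy bound. *)
Lemma summable_L1_limit (F : nat -> T -> R) (a : R) :
  (forall j, density mu (F j)) ->
  (forall j, (density_entropy mu (F j) <= (a + (4^-1) ^+ j)%:E)%E) ->
  (forall j, (L1dist (F j) (F j.+1) <= (6 * (2^-1) ^+ j)%:E)%E) ->
  exists f, [/\ density mu f, (density_entropy mu f <= a%:E)%E &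
    L1dist (F j) f @[j --> \oo] --> 0%E].
Proof.
move=> dF aF FF.
have mF j : measurable_fun [set: T] (F j) by have [] := dF j.
have F0 j x : 0 <= F j x by have [] := dF j.
have F1 j : (\int[mu]_x (F j x)%:E = 1)%E by have [] := dF j.
pose D j x : \bar R := `|F j x - F j.+1 x|%:E.
have mD j : measurable_fun [set: T] (D j) by exact: measurable_dist.
have D0 j x : (0 <= D j x)%E by rewrite lee_fin.
pose G x : \bar R := (\sum_(j <oo) D j x)%E.
have mG : measurable_fun [set: T] G.
  by apply: ge0_emeasurable_sum => // *; exact: D0.
have G0 x : (0 <= G x)%E by apply: nneseries_ge0 => *; exact: D0.
have iG : (\int[mu]_x G x < +oo)%E.
  rewrite integral_nneseries//.
  apply: (@le_lt_trans _ _ (\sum_(j <oo) (6 * (2^-1) ^+ j)%:E)%E).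
    apply: lee_nneseries => [j _ _|j _]; last exact: FF.
    by apply: integral_ge0 => x _; exact: D0.
  have := @cvg_geometric_series R 6 2^-1.
  rewrite ger0_norm// invf_lt1// ltr1n => /(_ isT) h.
  have -> : (\sum_(j <oo) (6 * (2^-1) ^+ j)%:E = (6 / (1 - 2^-1) : R)%:E)%E.
    apply: (cvg_lim (@ereal_hausdorff R)).
    under eq_fun do rewrite sumEFin.
    by apply: cvg_EFin; [exact: nearW|exact: h].
  exact: ltry.
have intG : mu.-integrable [set: T] G.
  apply/integrableP; split => //.
  by under eq_integral do rewrite gee0_abs//.
pose N := [set x | G x = +oo%E].
have mN : measurable N.
  by rewrite -[N]setTI; exact: mG (emeasurable_set1 _).
have N0 : {ae mu, forall x, ~ N x}.
  have := integrable_ae measurableT intG.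
  by apply: filterS => x /= /(_ I) + Nx; rewrite Nx.
(* Setting [F] to 0 on the null set makes the limit exist at every point, so that [f] is measurable
   and nonnegative everywhere. *)
pose F' j x : R := F j x * \1_(~` N) x.
have F'F j x : ~ N x -> F' j x = F j x.
  by move=> Nx; rewrite /F' indicE mem_set// mulr1.
have mF' j : measurable_fun [set: T] (F' j).
  by apply: measurable_funM => //; apply: measurable_indic; exact: measurableC.
have F'0 j x : 0 <= F' j x by rewrite mulr_ge0.
have F'cvg x : cvgn (F' ^~ x).
  have [Nx|Nx] := pselect (N x).
    rewrite (_ : F' ^~ x = cst 0); first exact: is_cvg_cst.
    by apply/funext => j; rewrite /F' indicE memNset ?mulr0//; exact.
  have -> : F' ^~ x = F ^~ x by apply/funext => j; exact: F'F.
  have Gx : (G x < +oo)%E by rewrite ltey; apply/eqP.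
  have GxE : G x \is a fin_num by rewrite ge0_fin_numE.
  have : cvgn (series (telescope (F ^~ x))).
    apply: (@normed_cvg R R^o); apply: nondecreasing_is_cvgn.
      by apply: nondecreasing_series => *; exact: normr_ge0.
    exists (fine (G x)) => _ [n _ <-]; rewrite -lee_fin fineK//.
    rewrite /series/= -sumEFin.
    apply: le_trans (@nneseries_lim_ge _ (D ^~ x) xpredT 0%N n _); last first.
      by move=> *; exact: D0.
    by apply: lee_sum => k _; rewrite /D distrC.
  move=> c; rewrite (_ : F ^~ x = cst (F 0%N x) \+ series (telescope (F ^~ x))).
    by apply: is_cvgD => //; exact: is_cvg_cst.
  by apply/funext => n; exact: eq_sum_telescope.
pose f x : R := limn (F' ^~ x).
have mf : measurable_fun [set: T] f.
  by apply: (@measurable_fun_cvg _ _ _ _ F') => // x _; exact: F'cvg.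
have f0 x : 0 <= f x by apply: limr_ge; [exact: F'cvg|exact: nearW].
have cF : {ae mu, forall x, [set: T] x -> EFin \o (F ^~ x) @ \oo --> (f x)%:E}.
  apply: filterS N0 => x Nx _; apply: cvg_EFin; first exact: nearW.
  rewrite [fine \o _](_ : _ = F ^~ x)//; have -> : F ^~ x = F' ^~ x by apply/funext => j; rewrite F'F.
  exact: F'cvg.
have domF x n : ~ N x -> ((F n x)%:E <= (F 0 x)%:E + G x)%E.
  move=> Nx; apply: (@le_trans _ _ ((F 0%N x)%:E + \sum_(0 <= j < n) D j x)%E).
    elim: n => [|n ih]; first by rewrite big_geq// adde0.
    rewrite big_nat_recr//= addeA; apply: (@le_trans _ _ ((F n x)%:E + D n x)%E).
      rewrite /D -EFinD lee_fin; have := ler_norm (F n.+1 x - F n x).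
      rewrite distrC; lra.
    by rewrite leeD2r.
  by rewrite leeD2l//; apply: nneseries_lim_ge.
have [|||||intf Ff If] := @dominated_convergence _ _ _ mu [set: T] measurableT
  (fun j x => (F j x)%:E) (EFin \o f) (fun x => (F 0 x)%:E + G x)%E.
- by move=> n; exact/measurable_EFinP.
- exact/measurable_EFinP.
- exact: cF.
- apply: integrableD => //; apply/integrableP; split; first exact/measurable_EFinP.
  under eq_integral do rewrite gee0_abs ?lee_fin//.
  by rewrite F1 ltry.
- apply: filterS N0 => x Nx n _; rewrite gee0_abs ?lee_fin//.
  exact: domF.
have f1 : (\int[mu]_x (f x)%:E = 1)%E.
  apply: (@cvg_unique _ _ _ _ _ _ If) => //=.
  by under eq_fun do rewrite F1; exact: cvg_cst.
exists f; split; [by []| |exact: Ff].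
have -> : density_entropy mu f =
   (\int[mu]_x limn_einf (fun j => (entropy_fun (F' j x))%:E))%E.
  apply: eq_integral => x _.
  have h := entropy_fun_cvg (fun j => F'0 j x) (F'cvg x).
  have /cvg_limn_einf_sup[-> _] // :
      EFin \o (entropy_fun \o F' ^~ x) @ \oo --> (entropy_fun (f x))%:E.
  by apply: cvg_EFin; [exact: nearW|exact: h].
apply: (le_trans (fatou _ _ _ _)) => //.
- by move=> j; apply/measurable_EFinP; exact: measurable_entropy_fun.
- by move=> j x _; rewrite lee_fin entropy_fun_ge0.
have -> : (fun j => \int[mu]_x (entropy_fun (F' j x))%:E)%E =
          (fun j => density_entropy mu (F j)).
  apply/funext => j; apply: ae_eq_integral => //.
  - by apply/measurable_EFinP; exact: measurable_entropy_fun.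
  - by apply/measurable_EFinP; exact: measurable_entropy_fun.
  - by apply: filterS N0 => x Nx _; rewrite F'F.
apply/lee_addgt0Pr => e e0; rewrite limn_einf_lim.
apply: lime_le; first exact: is_cvg_einfs.
apply: nearW => n.
(* The tail infimum from [n] on is at most the term of index [n + k], whose excess over [a] is at
   most [e]. *)
have [k k4] : exists k, (4^-1 : R) ^+ (n + k) <= e.
  have : (4^-1 : R) ^+ m @[m --> \oo] --> (0 : R).
    by apply: cvg_expr; rewrite ger0_norm// invf_lt1// ltr1n.
  move=> /cvgrPdist_le/(_ _ e0) [k _ /(_ (n + k)%N (leq_addl _ _))].
  by rewrite sub0r normrN ger0_norm// => h; exists k.
apply: (@le_trans _ _ (density_entropy mu (F (n + k)%N))).
  by apply: ereal_inf_lbound; exists (n + k)%N => //=; exact: leq_addr.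
by apply: (le_trans (aF _)); rewrite -EFinD lee_fin lerD2l.
Unshelve. all: by end_near. Qed.

(* Almost minimal elements [F j] of [D j] have midpoints that are almost minimal
   as well, hence are Cauchy in L1 by [L1dist_entropy]. *)
Lemma entropy_limit (D : nat -> set (T -> R)) (a : R) :
  (forall k f, D k f -> density mu f) ->
  (forall k f g, D k f -> D k g -> D k (fun x => (f x + g x) / 2)) ->
  (forall k m, (k <= m)%N -> D m `<=` D k) ->
  (forall k (e : R), 0 < e ->
    exists2 f, D k f & (density_entropy mu f <= (a + e)%:E)%E) ->
  exists f, [/\ density mu f, (density_entropy mu f <= a%:E)%E &
    exists F : nat -> T -> R, (forall j, D j (F j)) /\
      L1dist (F j) f @[j --> \oo] --> 0%E].
Proof.
move=> Dd Dmid Dmon Da.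
(* [sup S] is the limit of the infimum of the entropy over the decreasing sets [D k]. *)
pose S := [set r : R | exists k, forall f, D k f -> (r%:E <= density_entropy mu f)%E].
have hS : has_sup S.
  split; first by exists 0, 0%N => f /Dd; exact: density_entropy_ge0.
  exists (a + 1) => r [k rk]; have [f Df fa] := Da k 1 ltr01.
  by rewrite -lee_fin (le_trans (rk f Df)).
pose I := sup S.
have Ia : I <= a.
  apply: ge_sup; first by case: hS.
  move=> r [k rk]; apply/ler_addgt0Pr => e e0; have [f Df fa] := Da k e e0.
  by rewrite -lee_fin (le_trans (rk f Df)).
have c0 j : 0 < (4^-1 : R) ^+ j by rewrite exprn_gt0.
have /choice[K KP] : forall j, exists k, (j <= k)%N /\
    forall f, D k f -> ((I - 4^-1 ^+ j)%:E <= density_entropy mu f)%E.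
  move=> j; have [r [k rk] rI] := sup_adherent (c0 j) hS.
  exists (maxn j k); split; first exact: leq_maxl.
  move=> f /(Dmon k _ (leq_maxr _ _)) /rk; apply: le_trans.
  by rewrite lee_fin ltW.
have /choice[F FP] : forall j, exists f, D (K j) f /\
    (density_entropy mu f <= (I + 4^-1 ^+ j)%:E)%E.
  move=> j; apply: contrapT => /forallNP h.
  have : S (I + 4^-1 ^+ j).
    exists (K j) => f Df; have /not_andP[//|/negP] := h f.
    by rewrite -ltNge => /ltW.
  by move=> /(ub_le_sup hS.2); rewrite -/I gerDl leNgt c0.
have dF j : density mu (F j) by apply: (Dd (K j)); case: (FP j).
have [|j|f [df fI Ff]] := @summable_L1_limit F I dF.
- by move=> j; case: (FP j).
- have F1 := (FP j).2; have F2 : (density_entropy mu (F j.+1) <= (I + 4^-1 ^+ j)%:E)%E.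
    apply: (le_trans (FP j.+1).2); rewrite lee_fin lerD2l exprS.
    by rewrite ler_piMl// ?invf_le1 ?ler1n// ltW.
  have mid : ((I - 4^-1 ^+ j)%:E <=
      density_entropy mu (fun x => ((F j x + F j.+1 x) / 2)%R))%E.
    (* [K] may fail to be monotone: both densities lie in the [D] of the smaller index, whose lower
       bound applies to their midpoint. *)
    have [KK|KK] := leqP (K j) (K j.+1).
      apply: (KP j).2; apply: Dmid; first by case: (FP j).
      by apply: Dmon KK _ _; case: (FP j.+1).
    apply: (@le_trans _ _ (I - 4^-1 ^+ j.+1)%:E).
      rewrite lee_fin lerD2l lerN2 exprS.
      by rewrite ler_piMl// ?invf_le1 ?ler1n// ltW.
    apply: (KP j.+1).2; apply: Dmid; last by case: (FP j.+1).
    by apply: Dmon (ltnW KK) _ _; case: (FP j).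
  (* With [c = 4^-j], the choice [e = 2^-j] turns [4 c / e + 2 e] into [6 * 2^-j], which is
     summable. *)
  have e0 : 0 < (2^-1 : R) ^+ j by rewrite exprn_gt0.
  apply: le_trans (L1dist_entropy (dF j) (dF j.+1) e0 F1 F2 mid) _.
  rewrite lee_fin (_ : 4^-1 ^+ j = (2^-1 ^+ j) ^+ 2 :> R); last first.
    by rewrite -exprM mulnC exprM; congr (_ ^+ _); rewrite exprVn -natrX.
  by rewrite expr2 mulrA mulfK ?gt_eqF//; lra.
exists f; split => //; first by rewrite (le_trans fI).
exists F; split => // j; apply: Dmon (KP j).1 _ _.
by case: (FP j).
Qed.

End entropy_limit.

(** * The Frechet functional and the stability of its minimizers *)

Section kernel.
Context {R : realType} {X : pmetricType R} (cX : compact [set: X]).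
Variables (p : R) (p1 : 1 <= p).
Implicit Types (x y : X) (nu : probability (borel X) R).

Local Notation cost x y := ((mdist x y) `^ p).

Lemma mdist_bounded2 : exists2 M : R, 0 <= M & forall x y, mdist x y <= M.
Proof.
have [M MX] := mdist_bounded (point : X) cX.
have M0 : 0 <= M by apply: le_trans (MX point I); exact: mdist_ge0.
exists (M + M) => [|x y]; first by rewrite addr_ge0.
have := metric_triangle x point y; have := MX x I; have := MX y I.
rewrite (metric_sym x point); lra.
Qed.

Lemma cost_bounded : exists2 M : R, 0 < M & forall x y, cost x y <= M.
Proof.
have [M M0 MX] := mdist_bounded2.
exists (M `^ p + 1) => [|x y]; first by rewrite ltr_wpDl// powR_ge0.
rewrite (@le_trans _ _ (M `^ p)) ?lerDl//.
have p0 : 0 <= p := le_trans ler01 p1.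
by apply: ge0_ler_powR; rewrite ?nnegrE ?mdist_ge0.
Qed.

Lemma cost_lipschitz : exists2 L : R, 0 < L &
  forall x x' y, cost x y <= cost x' y + L * mdist x x'.
Proof.
have [M M0 MX] := mdist_bounded2.
have [L L0 LM] := powR_lipschitz p1 M0.
exists (L + 1) => [|x x' y]; first by rewrite ltr_wpDl.
apply: le_trans (LM (mdist x' y) _ (mdist_ge0 _ _) (mdist_ge0 _ _) (MX _ _)) _.
rewrite lerD2l; apply: (@le_trans _ _ (L * mdist x x')); last first.
  by rewrite ler_wpM2r ?mdist_ge0// lerDl.
rewrite ler_wpM2l//.
have h1 := metric_triangle x x' y; have h2 := metric_triangle x' x y.
rewrite (metric_sym x' x) in h2.
by rewrite ler_norml; apply/andP; split; lra.
Qed.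

Definition fmean nu x : R := fine (frechet_fun p nu x).

Lemma fmeanE nu x : (fmean nu x)%:E = frechet_fun p nu x.
Proof. by rewrite /fmean fineK// frechet_fun_fin. Qed.

Lemma frechet_meanP nu x :
  kset_set (frechet_mean cX p1 nu) x <-> forall x', fmean nu x <= fmean nu x'.
Proof.
split=> [h x'|h].
  have : (frechet_fun p nu x <= frechet_fun p nu x')%E := h x'.
  by rewrite -!fmeanE lee_fin.
suff : frechet_argmin p nu x by [].
by move=> x'; rewrite -!fmeanE lee_fin.
Qed.

Definition lip L (phi : X -> R) := forall x x', phi x <= phi x' + L * mdist x x'.

(** The cost is Lipschitz in its first argument uniformly in the second, so averaging keeps one
    constant for every [nu]. *)
Lemma fmean_lipschitz : exists2 L : R, 0 < L & forall nu, lip L (fmean nu).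
Proof.
have [L L0 LP] := cost_lipschitz; exists L => // nu x x'.
have c0 : 0 <= L * mdist x x' by rewrite mulr_ge0 ?mdist_ge0// ltW.
rewrite -lee_fin EFinD !fmeanE.
have -> : (L * mdist x x')%:E =
    (\int[nu]_(y in setT) (cst (L * mdist x x')%:E) y)%E.
  by rewrite integral_cst//= probability_setT mule1.
rewrite -ge0_integralD//; first last.
- exact: measurable_mdist_powR.
- by move=> y _; rewrite /= lee_fin powR_ge0.
apply: ge0_le_integral => //.
- by move=> y _; rewrite /= lee_fin powR_ge0.
- exact: measurable_mdist_powR.
- by apply: emeasurable_funD => //; exact: measurable_mdist_powR.
by move=> y _; rewrite /= -EFinD lee_fin.
Qed.

Lemma fmean_bounded : exists2 M : R, 0 < M & forall nu x, 0 <= fmean nu x <= M.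
Proof.
have [M M0 MP] := cost_bounded; exists M => // nu x.
rewrite -!lee_fin fmeanE frechet_fun_ge0/=.
have -> : (M%:E = \int[nu]_(y in setT) (cst M%:E) y)%E.
  by rewrite integral_cst//= probability_setT mule1.
apply: ge0_le_integral => //.
- by move=> y _; rewrite /= lee_fin powR_ge0.
- exact: measurable_mdist_powR.
- by move=> y _; rewrite lee_fin.
Qed.

Lemma finite_net (e : R) : 0 < e ->
  exists s : seq X, forall x, exists2 y, y \in s & mdist x y < e.
Proof.
move=> e0; move: cX; rewrite compact_cover => cov.
have [|x _|s _ sP] := cov X setT (fun y => (ball y e)°).
- by move=> y _; exact: open_interior.
- by exists x => //; exact: nbhsx_ballx.
exists s => x; have [y ys /interior_subset yx] := sP x I.
by exists y => //; move: yx; rewrite ballEmdist metric_sym.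
Qed.

(** On a net of radius [e / (2 L)] each function changes by at most [e / 2] between a point and its
    net neighbor, which adds at most [e] to the difference on the net. *)
Lemma lip_net (L e : R) : 0 < L -> 0 < e -> exists s : seq X,
  forall phi psi : X -> R, lip L phi -> lip L psi ->
  {in s, forall x, `|phi x - psi x| <= e} -> forall x, `|phi x - psi x| <= 2 * e.
Proof.
move=> L0 e0.
have [|s sP] := @finite_net (e / (2 * L)); first by rewrite divr_gt0// mulr_gt0.
exists s => phi psi lphi lpsi h x; have [y /h + xy] := sP x.
have Le : L * mdist x y <= e / 2.
  rewrite -ler_pdivlMl//; apply: (le_trans (ltW xy)).
  by rewrite le_eqVlt (_ : e / (2 * L) = L^-1 * (e / 2)) ?eqxx//; field; rewrite gt_eqF.
have h1 := lphi x y; have h2 := lphi y x.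
have h3 := lpsi x y; have h4 := lpsi y x.
rewrite (metric_sym y x) in h2 h4.
by rewrite !ler_norml => /andP[h5 h6]; apply/andP; split; lra.
Qed.

Lemma lip_continuous L (phi : X -> R) : 0 < L -> lip L phi ->
  continuous (phi : X -> R^o).
Proof.
move=> L0 LP x; apply/cvgrPdist_lt => e e0; near=> z.
have xz : L * mdist x z < e.
  have : ball x (e / L) z by near: z; apply: nbhsx_ballx; rewrite divr_gt0.
  by rewrite ballEmdist/= ltr_pdivlMr// mulrC.
have h1 := LP x z; have h2 := LP z x; rewrite (metric_sym z x) in h2.
by rewrite ltr_norml; apply/andP; split; lra.
Unshelve. all: by end_near. Qed.

(** On the compact set [K] of points at distance at least [e / 2] from the minimizers, [fmean nu]
    exceeds its minimum by a positive gap. A perturbation by a quarter of the gap changes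
    comparisons with a minimizer [c] by at most half of it, so no new minimizer lies in [K]. *)
Lemma frechet_mean_usc nu (e : R) : 0 < e -> exists2 dl : R, 0 < dl &
  forall nu', (forall x, `|fmean nu' x - fmean nu x| <= dl) ->
  rho (frechet_mean cX p1 nu') (frechet_mean cX p1 nu) < e.
Proof.
move=> e0; pose F nu' : set X := frechet_mean cX p1 nu'.
pose K := \bigcap_(c in F nu) [set x | e / 2 <= mdist c x].
have near_F nu' : (forall x, F nu' x -> ~ K x) -> rho (F nu') (F nu) < e.
  move=> FK; apply: (@le_lt_trans _ _ (e / 2)); last lra.
  apply: (@rho_le _ _ (frechet_mean cX p1 nu') (frechet_mean cX p1 nu)) => x /FK Kx; apply: contrapT => h; apply: Kx => c Fc /=.
  rewrite leNgt; apply/negP => cx; apply: h; exists c => //.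
  by rewrite metric_sym ltW.
have [K0|/set0P K0] := eqVneq K set0.
  by exists 1 => // nu' _; apply: near_F => x _; rewrite K0.
have [L L0 LP] := fmean_lipschitz.
have cK : compact K.
  apply: (subclosed_compact _ cX) => //.
  rewrite (_ : K = \bigcap_(c in F nu)
      ((mdist c : X -> R^o) @^-1` [set r | e / 2 <= r]))//.
  apply: closed_bigI => c _; apply: closed_comp; last exact: closed_ge.
  by move=> x _; exact: mdist_continuousr.
have [|x0 Kx0 x0min] := @compact_EVT_min X R (fmean nu) K K0 cK.
  exact/continuous_subspaceT/(lip_continuous L0 (LP nu)).
have [c Fc] := kset_neq0 (frechet_mean cX p1 nu).
have x0c : fmean nu c < fmean nu x0.
  rewrite ltNge; apply/negP => x0c.
  have Fx0 : F nu x0.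
    apply/frechet_meanP => x'; apply: (le_trans x0c).
    by move/frechet_meanP : Fc; exact.
  by have /set_mem/(_ _ Fx0) := Kx0; rewrite /= mdistxx; lra.
exists ((fmean nu x0 - fmean nu c) / 4).
  by rewrite divr_gt0// subr_gt0.
move=> nu' nu'P; apply: near_F => x /frechet_meanP/(_ c) xc Kx.
have := x0min x (mem_set Kx); have := nu'P x; have := nu'P c.
move: xc x0c; move: (fmean nu x) (fmean nu c) (fmean nu x0) => a b m.
move: (fmean nu' x) (fmean nu' c) => a' b'.
by rewrite !ler_norml => ? ? /andP[? ?] /andP[? ?] ?; lra.
Qed.

Lemma kset_open (V : set (kset X)) : open V ->
  forall C, V C -> exists2 e : R, 0 < e & forall C' : kset X, rho C' C < e -> V C'.
Proof.
rewrite openE => oV C /oV [e /= e0 eV]; exists e => // C' C'C.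
Qed.

Lemma frechet_mean_open nu (V : set (kset X)) : open V ->
  V (frechet_mean cX p1 nu) -> exists2 dl : R, 0 < dl &
  forall nu', (forall x, `|fmean nu' x - fmean nu x| <= dl) ->
  V (frechet_mean cX p1 nu').
Proof.
move=> oV /(kset_open oV)[e e0 eV]; have [dl dl0 dlP] := frechet_mean_usc nu e0.
by exists dl => // nu' /dlP; exact: eV.
Qed.

End kernel.

(** * Lower semicontinuity of the entropy *)

Section entropy_closure.
Context {R : realType} {X : pmetricType R} (cX : compact [set: X]).
Variables (p : R) (p1 : 1 <= p) (mu : probability (borel X) R).
Implicit Types (x y : X) (nu : probability (borel X) R) (f g : borel X -> R).

Local Notation cost x y := ((mdist x y) `^ p).

Definition cost_density f x : \bar R := (\int[mu]_y (cost x y * f y)%:E)%E.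

Lemma measurable_cost_density f x : measurable_fun [set: borel X] f ->
  measurable_fun [set: borel X] (fun y => (cost x y * f y)%:E).
Proof.
move=> mf; apply/measurable_EFinP; apply: measurable_funM => //.
exact: (measurableT_comp (measurable_powR p) (measurable_mdist x)).
Qed.

Lemma frechet_fun_density nu f x : density mu f -> has_density mu nu f ->
  frechet_fun p nu x = cost_density f x.
Proof.
move=> df nuf; rewrite /frechet_fun (has_density_density_measure df nuf).
- by apply: eq_integral => y _; rewrite EFinM.
- exact: measurable_mdist_powR.
- by move=> y; rewrite lee_fin powR_ge0.
Qed.

Lemma cost_density_L1 : exists2 M : R, 0 < M & forall f g x,
  density mu f -> density mu g ->
  (cost_density f x <= cost_density g x + M%:E * L1dist mu f g)%E.
Proof.
have [M M0 MP] := cost_bounded cX p1; exists M => // f g x [mf f0 f1] [mg g0 g1].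
rewrite /cost_density /L1dist -ge0_integralZl//; first last.
- by rewrite lee_fin ltW.
- exact: measurable_dist.
rewrite -ge0_integralD//; first last.
- by apply: emeasurable_funM => //; exact: measurable_dist.
- by move=> y _; rewrite mule_ge0// lee_fin ltW.
- exact: measurable_cost_density.
- by move=> y _; rewrite lee_fin mulr_ge0 ?powR_ge0.
apply: ge0_le_integral => //.
- by move=> y _; rewrite lee_fin mulr_ge0 ?powR_ge0.
- exact: measurable_cost_density.
- apply: emeasurable_funD; first exact: measurable_cost_density.
  by apply: emeasurable_funM => //; exact: measurable_dist.
move=> y _; rewrite -EFinM -EFinD lee_fin.
have h : cost x y * (f y - g y) <= M * `|f y - g y|.
  apply: (@le_trans _ _ (cost x y * `|f y - g y|)).
    by rewrite ler_wpM2l ?powR_ge0// ler_norm.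
  by rewrite ler_wpM2r.
by rewrite -lerBlDl -mulrBr.
Qed.

Lemma cost_density_fmean f x : density mu f ->
  exists2 nu, has_density mu nu f & cost_density f x = (fmean p nu x)%:E.
Proof.
move=> df; have [nu nuf] := density_has_density df; exists nu => //.
by rewrite fmeanE// (frechet_fun_density x df nuf).
Qed.

Lemma cost_density_midpoint f g x : density mu f -> density mu g ->
  (cost_density (fun y => (f y + g y) / 2)%R x =
   (2^-1)%:E * (cost_density f x + cost_density g x))%E.
Proof.
move=> [mf f0 f1] [mg g0 g1]; rewrite /cost_density.
rewrite -ge0_integralD//; try by move=> y _; rewrite lee_fin mulr_ge0 ?powR_ge0.
- rewrite -ge0_integralZl//; last 2 first.
  + by apply: emeasurable_funD; exact: measurable_cost_density.
  + by move=> y _; rewrite -EFinD lee_fin addr_ge0// mulr_ge0 ?powR_ge0.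
  by apply: eq_integral => y _; rewrite -EFinD -EFinM; congr EFin; field.
- exact: measurable_cost_density.
- exact: measurable_cost_density.
Qed.

(** The sets [D k] of densities whose [cost_density] is within [1 / (k + 1)] of [phi] decrease and
    are stable under midpoints, as [cost_density] is affine. [entropy_limit] gives an L1 limit, and
    the bounded cost makes its [cost_density] equal to [phi]. *)
Lemma entropy_closure (phi : X -> R) (a : R) :
  (forall e : R, 0 < e -> exists nu, (relative_entropy nu mu <= (a + e)%:E)%E /\
    forall x, `|fmean p nu x - phi x| <= e) ->
  exists nu, (relative_entropy nu mu <= a%:E)%E /\ fmean p nu =1 phi.
Proof.
move=> H.
pose D k := [set f | density mu f /\ forall x,
  ((phi x - k.+1%:R^-1)%:E <= cost_density f x <= (phi x + k.+1%:R^-1)%:E)%E].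
have k0 k : 0 < (k.+1%:R^-1 : R) by rewrite invr_gt0.
have [k f []//|k f g [df fP] [dg gP]|k m km f [df fP]|k e e0|] :=
    @entropy_limit _ _ _ mu D a.
- split; first exact: density_midpoint.
  move=> x; rewrite cost_density_midpoint//.
  move: (fP x) (gP x); have [? ? ->] := cost_density_fmean x df.
  have [? ? ->] := cost_density_fmean x dg.
  rewrite -EFinD -EFinM !lee_fin.
  move: (fmean p _ x) (fmean p _ x) (phi x) (k.+1%:R^-1 : R) => b b' q r.
  move=> /andP[? ?] /andP[? ?].
  by apply/andP; split; lra.
- split=> // x; have := fP x; have [? ? ->] := cost_density_fmean x df.
  rewrite !lee_fin; have : m.+1%:R^-1 <= k.+1%:R^-1 :> R.
    by rewrite lef_pV2 ?posrE// ler_nat.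
  move: (fmean p _ x) (phi x) (k.+1%:R^-1 : R) (m.+1%:R^-1 : R) => b q r r'.
  by move=> ? /andP[? ?]; apply/andP; split; lra.
- have [|nu [nua nuphi]] := H (Num.min e k.+1%:R^-1); first by rewrite lt_min e0 k0.
  have [|f [df nuf nuE]] := @relative_entropy_lty _ _ _ mu nu.
    by rewrite (le_lt_trans nua)// ltry.
  exists f; last first.
    by rewrite -nuE (le_trans nua)// lee_fin lerD2l ge_min lexx.
  split => // x; rewrite -(frechet_fun_density x df nuf) -fmeanE// !lee_fin.
  have := nuphi x; rewrite le_min => /andP[_].
  rewrite ler_norml; move: (fmean p _ x) (phi x) (k.+1%:R^-1 : R) => b q r.
  by move=> /andP[? ?]; apply/andP; split; lra.
move=> f [df fa [F [FD Ff]]].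
have [nu nuf] := density_has_density df.
exists nu; split; first by rewrite (relative_entropyE df nuf).
move=> x; have [M M0 MP] := cost_density_L1.
suff h (e : R) : 0 < e -> `|fmean p nu x - phi x| <= e.
  by apply/eqP; rewrite -subr_eq0 -normr_le0; apply/ler_addgt0Pr => e /h; rewrite add0r.
move=> e0.
have LFj j : (0 <= L1dist mu (F j) f)%E by apply: integral_ge0.
have : \forall j \near \oo, (L1dist mu (F j) f <= (e / (2 * M))%:E)%E.
  move/fine_cvgP : Ff => [fin /cvgrPdist_le/(_ (e / (2 * M)))].
  rewrite divr_gt0 ?mulr_gt0// => /(_ isT) h.
  near=> j; rewrite -(@fineK _ (L1dist _ _ _)); last by near: j.
  rewrite lee_fin; have : `|0 - fine (L1dist mu (F j) f)| <= e / (2 * M).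
    by near: j.
  by rewrite sub0r normrN => /(le_trans (ler_norm _)).
have : \forall j \near \oo, j.+1%:R^-1 <= e / 2 :> R.
  have := @cvg_harmonic R => /cvgrPdist_le/(_ (e / 2)).
  rewrite divr_gt0// => /(_ isT); apply: filterS => j /=.
  by rewrite sub0r normrN ger0_norm.
move=> h1 h2; near \oo => j.
have h3 : j.+1%:R^-1 <= e / 2 :> R by near: j.
have LM : (M%:E * L1dist mu (F j) f <= (e / 2)%:E)%E.
  have -> : e / 2 = M * (e / (2 * M)) by field; rewrite gt_eqF.
  by rewrite EFinM lee_pmul2l// ?lte_fin//; near: j.
have [dF /(_ x)] := FD j.
have := MP (F j) f x dF df; have := MP f (F j) x df dF.
have -> : L1dist mu f (F j) = L1dist mu (F j) f.
  by apply: eq_integral => y _; rewrite distrC.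
rewrite -(frechet_fun_density x df nuf) -fmeanE//.
have [? ? ->] := cost_density_fmean x dF; move: (fmean p _ x) => b.
move=> /le_trans/(_ (leeD2l _ LM)) + /le_trans/(_ (leeD2l _ LM)).
rewrite -!EFinD !lee_fin ler_norml; move: h3.
move: (fmean p _ x) (phi x) (j.+1%:R^-1 : R) => b' q r ? ? ? /andP[? ?].
by apply/andP; split; lra.
Unshelve. all: by end_near. Qed.

End entropy_closure.

(** * Compactness for uniform convergence *)

Section frechet_compactness.
Context {R : realType} {X : pmetricType R} (cX : compact [set: X]).
Variables (p : R) (p1 : 1 <= p).
Implicit Types (x y : X) (nu : probability (borel X) R).

Local Notation fmean := (fmean p).

(** A cluster point in the segment is a limit, because an ultrafilter contains each set or its
    complement. *)
Lemma ultra_bounded_limit T (U : set_system T) (FU : UltraFilter U)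
    (u : T -> R) (M : R) : (forall t, 0 <= u t <= M) ->
  exists l : R, forall e : R, 0 < e -> \forall t \near U, `|u t - l| <= e.
Proof.
move=> uM; have PU := @ultra_proper _ _ FU.
have [|l [_ lP]] := @segment_compact R 0 M (u @ U) _.
  by apply: nearW => t /=; rewrite in_itv/= uM.
exists l => e e0.
have [//|UC] := in_ultra_setVsetC [set t | `|u t - l| <= e] FU.
have [||r [/= [t /= ut <-] lt]] := lP (u @` ~` [set t | `|u t - l| <= e]) (ball l e).
- by apply: (@filterS _ U _ _ (u @^-1` (u @` _)) _ UC) => t ?; exists t.
- exact: nbhsx_ballx.
by exfalso; apply: ut; rewrite distrC; exact: ltW.
Qed.

(** Ascoli by an ultrafilter refining [G]: the pointwise limit [phi] inherits the Lipschitz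
    constant, and a finite net makes the closeness uniform. The first clause reduces uniform
    closeness to [phi] to finitely many conditions, as needed to build slabs. *)
Lemma fmean_cluster T (G : set_system T) {PG : ProperFilter G}
    (nu : T -> probability (borel X) R) : exists phi : X -> R,
  (forall e : R, 0 < e -> exists s : seq X, forall nu',
    {in s, forall x, `|fmean nu' x - phi x| <= e} ->
    forall x, `|fmean nu' x - phi x| <= 2 * e) /\
  (forall B, G B -> forall e : R, 0 < e ->
    exists2 t, B t & forall x, `|fmean (nu t) x - phi x| <= e).
Proof.
have [U [FU GU]] := ultraFilterLemma PG; have PU := @ultra_proper _ _ FU.
have [M M0 MP] := fmean_bounded cX p1.
have [L L0 LP] := fmean_lipschitz cX p1.
have /choice[phi phiP] : forall x, exists l : R, forall e : R, 0 < e ->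
    \forall t \near U, `|fmean (nu t) x - l| <= e.
  by move=> x; exact: (@ultra_bounded_limit _ U FU (fun t => fmean (nu t) x) M).
have lphi : lip L phi.
  move=> x x'; apply/ler_addgt0Pr => e e0.
  have e20 : 0 < e / 2 by rewrite divr_gt0.
  have : U ([set t | `|fmean (nu t) x - phi x| <= e / 2] `&`
      [set t | `|fmean (nu t) x' - phi x'| <= e / 2]).
    by apply: filterI; exact: phiP.
  move=> /filter_ex[t [/=]]; rewrite !ler_norml; have := LP (nu t) x x'.
  move: (phi x) (phi x') (fmean _ x) (fmean _ x') (L * _) => a b c d q.
  by move=> ? /andP[? ?] /andP[? ?]; lra.
have net (e : R) : 0 < e -> exists s : seq X, forall nu',
    {in s, forall x, `|fmean nu' x - phi x| <= e} ->
    forall x, `|fmean nu' x - phi x| <= 2 * e.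
  move=> e0; have [s sP] := lip_net cX L0 e0; exists s => nu'.
  exact: sP.
exists phi; split => // B GB e e0.
have e20 : 0 < e / 2 by rewrite divr_gt0.
have [s sP] := net _ e20.
suff : U [set t | {in s, forall x, `|fmean (nu t) x - phi x| <= e / 2}].
  move=> /(filterI (GU _ GB)) /filter_ex[t [Bt /sP h]].
  by exists t => // x; rewrite (le_trans (h x))// mulrC divfK.
elim: s {sP} => [|x s ih]; first exact: nearW.
apply: filterS (filterI (phiP x _ e20) ih) => t [/= h1 h2] y.
by rewrite inE => /predU1P[->//|]; exact: h2.
Qed.

(* Accumulation point along the finite subsets of [D]: no finite subfamily of
   the [Q i] covers [bad], so some limit function escapes all of them. *)
Lemma fmean_finite_selection (I : choiceType) (D : set I)
    (Q : I -> set (probability (borel X) R)) (bad : set (probability (borel X) R)) :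
  ~ (exists2 s : {fset I}, {subset s <= D} &
       forall nu, bad nu -> exists2 i, i \in s & Q i nu) ->
  exists phi : X -> R,
  (forall e : R, 0 < e -> exists s : seq X, forall nu',
    {in s, forall x, `|fmean nu' x - phi x| <= e} ->
    forall x, `|fmean nu' x - phi x| <= 2 * e) /\
  (forall s : {fset I}, {subset s <= D} -> forall e : R, 0 < e ->
    exists nu, [/\ bad nu, forall i, i \in s -> ~ Q i nu &
      forall x, `|fmean nu x - phi x| <= e]).
Proof.
move=> nocov.
have /choice[nu nuP] : forall s : {fset I}, exists nu : probability (borel X) R,
    {subset s <= D} -> bad nu /\ forall i, i \in s -> ~ Q i nu.
  (* [dirac point] is a default value for families outside [D], on which nothing is required. *)
  move=> s; have [sD|sD] := pselect {subset s <= D}; last by exists (dirac point).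
  apply: contrapT => h; apply: nocov; exists s => // nu bnu.
  apply: contrapT => h'; apply: h; exists nu => _; split => // i si Qi.
  by apply: h'; exists i.
pose G := filter_from [set s : {fset I} | {subset s <= D}]
  (fun s => [set s' : {fset I} | {subset s' <= D} /\ {subset s <= s'}]).
have PG : ProperFilter G.
  apply: filter_from_proper; last by move=> s /= sD; exists s; split.
  apply: filter_from_filter; first by exists fset0.
  move=> s1 s2 /= s1D s2D; exists (s1 `|` s2)%fset.
    by move=> i; rewrite inE => /orP[/s1D|/s2D].
  by move=> s [/= sD s12]; split; split => // i si; apply: s12; rewrite inE si ?orbT.
have [phi [net phiP]] := fmean_cluster (G := G) nu.
exists phi; split => // s sD e e0.
have [|s' [s'D ss'] h] := phiP [set s' : {fset I} | {subset s' <= D} /\ {subset s <= s'}] _ e e0.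
  by exists s.
have [bs' ns'] := nuP s' s'D; exists (nu s'); split => // i /ss'; exact: ns'.
Qed.

End frechet_compactness.

(** * The rate function: sublevel sets, covers by slabs and the entropy gap *)

Section rate.
Context {R : realType} {X : pmetricType R} (cX : compact [set: X]).
Variables (p : R) (p1 : 1 <= p) (mu : probability (borel X) R).
Implicit Types (x y : X) (nu : probability (borel X) R).

Local Notation fmean := (fmean p).
Local Notation F := (frechet_mean cX p1).
Local Notation H nu := (relative_entropy nu mu).
Local Notation rate := (rate cX p1 mu).

Lemma rate_ge0 C : (0 <= rate C)%E.
Proof. by apply: le_ereal_inf_tmp => _ [nu _ <-]; exact: relative_entropy_ge0. Qed.

Lemma rate_le nu (C : kset X) : C `<=` F nu -> (rate C <= H nu)%E.
Proof. by move=> CF; apply: ereal_inf_lbound; exists nu. Qed.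

(** Measures with entropies at most [a + 1 / (n + 1)] accumulate at some [phi], realized by a
    measure of entropy at most [a]. Each point of [C] minimizes every [fmean (nu n)], hence also
    [phi]. *)
Lemma rate_attained (C : kset X) (a : R) : (rate C <= a%:E)%E ->
  exists2 nu, (H nu <= a%:E)%E & C `<=` F nu.
Proof.
move=> Ca.
have /choice[nu nuP] : forall n : nat, exists nu,
    (H nu <= (a + n.+1%:R^-1)%:E)%E /\ C `<=` F nu.
  move=> n; apply: contrapT => /forallNP h.
  suff : ((a + n.+1%:R^-1)%:E <= rate C)%E.
    by move=> /le_trans/(_ Ca); rewrite lee_fin gerDl leNgt invr_gt0 ltr0n.
  apply: le_ereal_inf_tmp => _ [nu /= CF <-].
  by have /not_andP[/negP|//] := h nu; rewrite -ltNge => /ltW.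
have [phi [_ phiP]] := fmean_cluster cX p1 (G := \oo) nu.
have [e e0|nus [nusa nusphi]] := @entropy_closure _ _ cX _ p1 mu phi a.
  have : \forall n \near \oo, n.+1%:R^-1 <= e :> R.
    have := @cvg_harmonic R => /cvgrPdist_le/(_ e e0); apply: filterS => j /=.
    by rewrite sub0r normrN ger0_norm.
  move=> /phiP/(_ e e0)[n /= ne nphi]; exists (nu n); split => //.
  by rewrite (le_trans (nuP n).1)// lee_fin lerD2l.
exists nus => // c Cc; apply/(frechet_meanP cX p1) => x'.
apply/ler_addgt0Pr => e e0.
have e20 : 0 < e / 2 by rewrite divr_gt0.
have [n _ nphi] := phiP setT filterT (e / 2) e20.
have /(frechet_meanP cX p1)/(_ x') := (nuP n).2 _ Cc.
have := nphi c; have := nphi x'; rewrite !nusphi !ler_norml.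
move: (phi c) (phi x') (fmean _ c) (fmean _ x') => a1 b1 c1 d1.
by move=> /andP[? ?] /andP[? ?] ?; lra.
Qed.

(** [rho C C'] is at most 0 for a subset [C] of [C']: open sets of the upper Hausdorff topology are
    downward closed. *)
Lemma kset_open_sub (V : set (kset X)) (C C' : kset X) : open V ->
  V C' -> C `<=` C' -> V C.
Proof.
move=> oV /(kset_open oV)[e e0 eV] CC'; apply: eV; apply: le_lt_trans e0.
by apply: rho_le => x Cx; exists x; [exact: CC'|rewrite mdistxx].
Qed.

(** By [rate_attained] and [kset_open_sub], only the sets [F nu] with [H nu <= a] have to be
    covered. Without a finite subcover there is a limit [phi] of escaping measures; it equals
    [fmean nu] for such a [nu], and an open set of the cover containing [F nu] also contains [F nu']
    for [nu'] near it. *)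
Lemma rate_compact (a : R) :
  cover_compact [set C : kset X | (rate C <= a%:E)%E].
Proof.
move=> I D V oV cov.
suff [s sD sP] : exists2 s : {fset I}, {subset s <= D} &
    forall nu, (H nu <= a%:E)%E -> exists2 i, i \in s & V i (F nu).
  exists s => // C /rate_attained[nu nua CF].
  have [i si Vi] := sP nu nua; exists i => //.
  by apply: kset_open_sub (oV i _) Vi CF; exact/set_mem/sD.
apply: contrapT => /(fmean_finite_selection cX p1)[phi [_ phiP]].
have [e e0|nu [nua nuphi]] := @entropy_closure _ _ cX _ p1 mu phi a.
  have [|nu [nua _ nuphi]] := phiP fset0 _ e e0; first by [].
  by exists nu; split => //; rewrite (le_trans nua)// lee_fin lerDl ltW.
have [|i Di Vi] := cov (F nu); first exact: le_trans (@rate_le nu (F nu) (fun _ h => h)) nua.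
have [dl dl0 dlP] := frechet_mean_open (oV i Di) Vi.
have [|nu' [_ /(_ i (fset11 i)) nVi h]] := phiP [fset i]%fset _ dl dl0.
  by move=> j /fset1P ->; exact/mem_set.
by apply/nVi/dlP => x; rewrite nuphi.
Qed.

(** The triple holds the points, the center and the tolerance. A slab is convex in [nu], so
    conditional means stay inside, and it tests finitely many integrals, so it gives a measurable
    event. *)
Definition slab (t : seq X * (X -> R) * R) : set (probability (borel X) R) :=
  [set nu | {in t.1.1, forall x, `|fmean nu x - t.1.2 x| <= t.2}].

Lemma bad_cover (V : set (kset X)) (a : R) : open V ->
  (forall nu, (H nu <= a%:E)%E -> V (F nu)) ->
  exists2 s : seq (seq X * (X -> R) * R),
    {in s, forall t nu, slab t nu -> (a%:E < H nu)%E} &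
    forall nu, ~ V (F nu) -> exists2 t, t \in s & slab t nu.
Proof.
move=> oV aV.
pose D := [set t | forall nu, slab t nu -> (a%:E < H nu)%E].
suff [s sD sP] : exists2 s : {fset (seq X * (X -> R) * R)}, {subset s <= D} &
    forall nu, ~ V (F nu) -> exists2 t, t \in s & slab t nu.
  by exists s => // t /sD/set_mem.
apply: contrapT => /(fmean_finite_selection cX p1)[phi [net phiP]].
(* If all entropies near [phi] exceed [a], a slab around [phi] on a finite net is admissible, but a
   measure close to [phi] was chosen outside it. *)
have [[e [e0 eP]]|ne] := pselect (exists e : R, 0 < e /\ forall nu,
    (forall x, `|fmean nu x - phi x| <= e) -> (a%:E < H nu)%E).
  have e20 : 0 < e / 2 by rewrite divr_gt0.
  have [s sP] := net _ e20.
  pose t := (s, phi, e / 2).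
  have Dt : D t.
    move=> nu /sP h; apply: eP => x; rewrite (le_trans (h x))//.
    by rewrite mulrC divfK.
  have [|nu [_ /(_ t (fset11 t)) nt h]] := phiP [fset t]%fset _ (e / 2) e20.
    by move=> j /fset1P ->; exact/mem_set.
  by apply: nt => x _; exact: h.
(* Otherwise [phi] is [fmean nu] with [H nu <= a]; then [V] holds near [phi], against the choice of
   bad measures there. *)
have [e e0|nu [nua nuphi]] := @entropy_closure _ _ cX _ p1 mu phi a.
  apply: contrapT => h; apply: ne; exists e; split => // nu nuphi.
  rewrite ltNge; apply/negP => nua; apply: h; exists nu; split => //.
  by rewrite (le_trans nua)// lee_fin lerDl ltW.
have [dl dl0 dlP] := frechet_mean_open oV (aV _ nua).
have [|nu' [nV _ h]] := phiP fset0 _ dl dl0; first by [].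
by apply/nV/dlP => x; rewrite nuphi.
Qed.

(** [L1dist_entropy] with [I = c = 0] compares the density with the constant 1, of entropy 0, at
    every tolerance; the two agree in L1 and give the same [fmean]. *)
Lemma relative_entropy_le0 nu : (H nu <= 0)%E -> fmean nu =1 fmean mu.
Proof.
move=> H0 x.
have [|f [df nuf nuE]] := @relative_entropy_lty _ _ _ mu nu.
  by rewrite (le_lt_trans H0)// ltry.
have d1 : density mu (cst 1).
  split => //; transitivity (\int[mu]_x cst 1%E x)%E => //.
  by rewrite integral_cst//= mul1e probability_setT.
have mu1 : has_density mu mu (cst 1).
  move=> A mA; transitivity (\int[mu]_(x in A) cst 1%E x)%E => //.
  by rewrite integral_cst//= mul1e.
have L0 : L1dist mu f (cst 1) = 0%E.
  apply/eqP; rewrite eq_le integral_ge0 ?andbT//.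
  apply/lee_addgt0Pr => e e0; rewrite add0e.
  have e20 : 0 < e / 2 by rewrite divr_gt0.
  have := @L1dist_entropy _ _ _ mu f (cst 1) (e / 2) 0 0 df d1 e20.
  rewrite addr0 subr0 mulr0 mul0r add0r mulrC divfK//; apply.
  - by rewrite -nuE.
  - rewrite /density_entropy (eq_integral (cst 0%E)) ?integral0// => y _.
    by congr EFin; rewrite /entropy_fun ln1 mulr0 sub0r addNr.
  - by apply: density_entropy_ge0; exact: density_midpoint.
have [M M0 MP] := cost_density_L1 cX p1 mu.
have := MP f (cst 1) x df d1; have := MP (cst 1) f x d1 df.
have -> : L1dist mu (cst 1) f = L1dist mu f (cst 1).
  by apply: eq_integral => y _; rewrite distrC.
rewrite L0 mule0 !adde0 -(frechet_fun_density p x df nuf).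
rewrite -(frechet_fun_density p x d1 mu1) => h1 h2.
by congr fine; apply/eqP; rewrite eq_le h1 h2.
Qed.

(** Otherwise measures of entropy at most [1 / (n + 1)] with distant Frechet means accumulate at the
    [fmean] of a zero-entropy measure, that is at [fmean mu], against upper semicontinuity at
    [mu]. *)
Lemma entropy_gap (e : R) : 0 < e -> exists2 a : R, 0 < a &
  forall nu, (H nu <= a%:E)%E -> rho (F nu) (F mu) < e.
Proof.
move=> e0; apply: contrapT => h.
have /choice[nu nuP] : forall n : nat, exists nu,
    (H nu <= (n.+1%:R^-1)%:E)%E /\ ~ rho (F nu) (F mu) < e.
  move=> n; apply: contrapT => /forallNP h'; apply: h.
  exists n.+1%:R^-1 => [|nu nua]; first by rewrite invr_gt0.
  by apply: contrapT => h; apply: (h' nu).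
have [phi [_ phiP]] := fmean_cluster cX p1 (G := \oo) nu.
have [r r0|nus [nusa nusphi]] := @entropy_closure _ _ cX _ p1 mu phi 0.
  have : \forall n \near \oo, n.+1%:R^-1 <= r :> R.
    have := @cvg_harmonic R => /cvgrPdist_le/(_ r r0); apply: filterS => j /=.
    by rewrite sub0r normrN ger0_norm.
  move=> /phiP/(_ r r0)[n /= nr nphi]; exists (nu n); split => //.
  by rewrite add0r (le_trans (nuP n).1).
have [dl dl0 dlP] := frechet_mean_usc cX p1 mu e0.
have [n _ nphi] := phiP setT filterT dl dl0.
apply: (nuP n).2; apply: dlP => x.
by rewrite -(relative_entropy_le0 nusa) nusphi.
Qed.

End rate.

(** * Products of densities along an i.i.d. sequence *)

Section iid_product.
Context {d d'} {Omega : measurableType d} {T : measurableType d'} {R : realType}.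
Variables (P : probability Omega R) (Y : nat -> {RV P >-> T}).
Variables (mu : probability T R) (iidY : iid P Y mu).

Lemma measurable_RV i : measurable_fun [set: Omega] (Y i : Omega -> T).
Proof. exact: measurable_funP. Qed.

Lemma iid_preimage i S : measurable S -> P (Y i @^-1` S) = mu S.
Proof. by move=> mS; rewrite -(iidY.2 i S mS). Qed.

Variables (f : T -> R) (df : density mu f).

Lemma measurable_iid_prod k :
  measurable_fun [set: Omega] (fun w => \prod_(i < k) f (Y i w)).
Proof.
apply: measurable_prod => i _.
by have [mf _ _] := df; exact: (measurableT_comp mf (measurable_RV i)).
Qed.

Let iid_prod_ge0 k w : 0 <= \prod_(i < k) f (Y i w).
Proof. by apply: prodr_ge0 => i _; have [_ f0 _] := df. Qed.

Let measurable_cylinder (J : {fset nat}) (B : nat -> set T) :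
  (forall i, i \in J -> measurable (B i)) ->
  measurable (\bigcap_(i in [set` J]) Y i @^-1` B i).
Proof.
move=> mB; apply: fin_bigcap_measurable => [|i /= iJ]; first exact: finite_fset.
by rewrite -[X in measurable X]setTI; apply: measurable_RV => //; exact: mB.
Qed.

(* By induction on [k], the law of [Y k] under the measure with density
   [\prod_(i < k) f (Y i)] on a cylinder over the later indices is a multiple
   of [mu], so that [f (Y k)] integrates to one factor [\int f dmu = 1]. *)
Lemma integral_iid_prod_cylinder k (J : {fset nat}) (B : nat -> set T) :
  (forall i, i \in J -> measurable (B i)) -> (forall i, i \in J -> (k <= i)%N) ->
  (\int[P]_(w in \bigcap_(i in [set` J]) Y i @^-1` B i)
     (\prod_(i < k) f (Y i w))%:E = \prod_(i <- J) mu (B i))%E.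
Proof.
elim: k J B => [|k ih] J B mB kJ.
  under eq_integral do rewrite big_ord0.
  transitivity (\int[P]_(w in \bigcap_(i in [set` J]) Y i @^-1` B i) cst 1%E w)%E => //.
  rewrite integral_cst//; last exact: measurable_cylinder.
  rewrite mul1e; transitivity (\prod_(i <- J) P (Y i @^-1` B i))%E.
    exact: iidY.1.
  rewrite !big_seq; apply: eq_bigr => i iJ.
  exact: iid_preimage (mB i iJ).
have [mf f0 f1] := df.
have kJN : k \notin J by apply/negP => /kJ; rewrite ltnn.
pose E := \bigcap_(i in [set` J]) Y i @^-1` B i.
have mE : measurable E by exact: measurable_cylinder.
pose W w := (\prod_(i < k) f (Y i w)) * \1_E w.
have mW : measurable_fun [set: Omega] W.
  by apply: measurable_funM; [exact: measurable_iid_prod|exact: measurable_indic].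
have W0 w : 0 <= W w by rewrite mulr_ge0// iid_prod_ge0.
pose c : R := \prod_(i <- J) fine (mu (B i)).
have c0 : 0 <= c by apply: prodr_ge0 => i _; exact: fine_ge0.
have cE : (\prod_(i <- J) mu (B i) = c%:E)%E.
  rewrite /c big_seq [in RHS]big_seq -prodEFin; apply: eq_bigr => i iJ.
  by rewrite fineK// fin_num_measure//; exact: mB.
have law S : measurable S ->
    pushforward (density_measure P mW W0) (Y k) S = mscale (NngNum c0) mu S.
  (* The cylinder gains the constraint [S] at the index [k], absent from [J], so that the induction
     hypothesis computes the law of [Y k]. *)
  move=> mS; pose B' i := if i == k then S else B i.
  have mB' i : i \in (k |` J)%fset -> measurable (B' i).
    rewrite !inE /B' => /predU1P[->|iJ]; first by rewrite eqxx.
    by case: eqP => // _; exact: mB.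
  have kJ' i : i \in (k |` J)%fset -> (k <= i)%N.
    by rewrite !inE => /predU1P[->//|/kJ/ltnW].
  have capE : \bigcap_(i in [set` (k |` J)%fset]) Y i @^-1` B' i =
      Y k @^-1` S `&` E.
    apply/seteqP; split => [w h|w [Sw Ew] i /=].
      split; first by have := h k; rewrite /= /B' eqxx; apply; rewrite !inE eqxx.
      move=> i /= iJ; have := h i; rewrite /= /B'; case: eqP => [ik|_].
        by move: kJN; rewrite -ik iJ.
      by apply; rewrite !inE iJ orbT.
    rewrite !inE /B' => /predU1P[->|iJ]; first by rewrite eqxx.
    by case: eqP => [->//|_]; exact: Ew.
  have := ih _ _ mB' kJ'; rewrite capE integral_mkcondr.
  rewrite big_fsetU1//= [B' k]/B' eqxx.
  have -> : (\prod_(i <- J) mu (B' i) = c%:E)%E.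
    rewrite -cE big_seq [RHS]big_seq; apply: eq_bigr => i iJ.
    by rewrite /B'; case: eqP => // ik; move: kJN; rewrite -ik iJ.
  rewrite /pushforward /mscale/= /density_measure muleC => <-.
  apply: eq_integral => w _; rewrite patchE /W indicE.
  by case: ifPn; rewrite ?mulr1// mulr0.
transitivity (\int[P]_w ((f (Y k w))%:E * (W w)%:E))%E.
  rewrite integral_mkcond; apply: eq_integral => w _.
  rewrite patchE big_ord_recr/= /W; case: ifPn => wE.
    by rewrite indicE wE mulr1 -EFinM mulrC.
  by rewrite indicE (negbTE wE) !mulr0 mule0.
have mfY : measurable_fun [set: Omega] (fun w => (f (Y k w))%:E).
  by apply/measurable_EFinP; exact: (measurableT_comp mf (measurable_RV k)).
rewrite -(ge0_integral_density P mW W0 mfY); last by move=> w; rewrite lee_fin.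
have mEf : measurable_fun [set: T] (EFin \o f) by exact/measurable_EFinP.
have := @ge0_integral_pushforward _ _ _ _ R _ (measurable_RV k)
  (density_measure P mW W0) setT (EFin \o f) measurableT mEf.
rewrite preimage_setT => <-; last by move=> y _; rewrite /= lee_fin.
rewrite (eq_measure_integral (mscale (NngNum c0) mu)); last by move=> S mS _; exact: law.
rewrite ge0_integral_mscale//; last by move=> y _; rewrite /= lee_fin.
by rewrite f1 mule1/= cE.
Qed.

Lemma integral_iid_prod k : (\int[P]_w (\prod_(i < k) f (Y i w))%:E = 1)%E.
Proof.
have := @integral_iid_prod_cylinder k fset0 (fun=> setT).
by rewrite set_fset0 bigcap_set0 big_seq_fset0 => ->.
Qed.

End iid_product.

(** * Mean of the empirical measure under a changed probability *)

Section weighted_empirical.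
Context {d d'} {Omega : measurableType d} {T : measurableType d'} {R : realType}.
Variables (P : probability Omega R) (Y : nat -> {RV P >-> T}) (n : nat).
Variables (W : Omega -> R) (mW : measurable_fun [set: Omega] W).
Variables (W0 : forall w, 0 <= W w) (W1 : (\int[P]_w (W w)%:E = 1)%E).

Let Q : probability Omega R := density_probability mW W0 W1.

(* The expectation of the empirical measure under the probability [W P]. *)
Definition weighted_empirical : set T -> \bar R :=
  mscale (n.+1%:R^-1 : R)%:nng (msum (fun i => distribution Q (Y i)) n.+1).

HB.instance Definition _ := Measure.on weighted_empirical.

Let weighted_empirical_setT : weighted_empirical setT = 1%E.
Proof.
rewrite /weighted_empirical /mscale/= /msum.
rewrite (eq_bigr (fun=> 1%E)); last by move=> i _; exact: probability_setT.
by rewrite sumEFin sumr_const card_ord -EFinM mulVf.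
Qed.

HB.instance Definition _ :=
  Measure_isProbability.Build _ _ _ weighted_empirical weighted_empirical_setT.

Lemma integral_weighted_empirical (g : T -> \bar R) : measurable_fun [set: T] g ->
  (forall y, 0 <= g y)%E ->
  (\int[weighted_empirical]_y g y =
   (n.+1%:R^-1)%:E * \sum_(i < n.+1) \int[P]_w (g (Y i w) * (W w)%:E))%E.
Proof.
move=> mg g0.
rewrite (eq_measure_integral
  (mscale (n.+1%:R^-1 : R)%:nng (msum (fun i => distribution Q (Y i)) n.+1)))//.
rewrite ge0_integral_mscale//=; congr (_ * _)%E.
rewrite ge0_integral_measure_sum//; apply: eq_bigr => i _.
have mgY : measurable_fun [set: Omega] (g \o Y i) by exact: measurableT_comp.
rewrite (@ge0_integral_distribution _ _ _ _ _ Q (Y i))//.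
rewrite -(ge0_integral_density P mW W0 mgY) => [|w]; last exact: g0.
by apply: eq_measure_integral.
Qed.

Variables (mu : probability T R) (iidY : iid P Y mu).

(** Each [Y i] has law [mu] under [P], and [W P] is dominated by [P]. *)
Lemma weighted_empirical_dominates : weighted_empirical `<< mu.
Proof.
apply/null_content_dominatesP => S mS S0.
rewrite /weighted_empirical /mscale/= /msum big1 ?mule0// => i _.
have mYS : measurable (Y i @^-1` S).
  by rewrite -[X in measurable X]setTI; apply: measurable_funP.
rewrite /distribution /pushforward/= /density_probability /density_measure.
apply: null_set_integral => //.
- by apply: measurable_funTS; exact/measurable_EFinP.
- exact: etrans (iid_preimage iidY i mS) S0.
Qed.

End weighted_empirical.

(** * Entropy of the conditional mean of the empirical measure *)

Section conditional_entropy.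
Context {R : realType}.

Let lp t : \bar R := maxe (lne t%:E) 0%E.
Let lm t : \bar R := maxe (- lne t%:E)%E 0%E.

Let lp0 t : (0 <= lp t)%E. Proof. by rewrite le_max lexx orbT. Qed.
Let ln0 t : (0 <= lm t)%E. Proof. by rewrite le_max lexx orbT. Qed.

Lemma ln_prod k (u : nat -> R) : (forall i, (i < k)%N -> 0 < u i) ->
  ln (\prod_(i < k) u i) = \sum_(i < k) ln (u i).
Proof.
elim: k => [|k ih] u0; first by rewrite !big_ord0 ln1.
rewrite !big_ord_recr/= lnM ?posrE ?u0// ?ih// => [i ik|].
  by rewrite u0// ltnW.
by apply: prodr_gt0 => i _; rewrite u0// ltnW// ltnS.
Qed.

(* [ln z <= b z - 1 - ln b] for [z = \prod_i u i], with the positive and negative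
   parts of the logarithms moved so that vanishing factors are harmless. *)
Lemma lne_prod_le (b : R) (u : nat -> R) k : 0 < b -> (forall i, 0 <= u i) ->
  (\sum_(i < k) maxe (lne (u i)%:E) 0 + 1 <=
   (b * \prod_(i < k) u i)%:E + (- ln b)%:E +
   \sum_(i < k) maxe (- lne (u i)%:E) 0)%E.
Proof.
(* A zero factor makes the right-hand side [+oo] through its negative part. *)
move=> b0 u0; have [|pos] := pselect (exists i : 'I_k, u i = 0).
  move=> [i ui]; rewrite [X in (_ <= _ + X)%E](bigD1 i)//.
  have -> : maxe (- lne (u i)%:E)%E 0%E = +oo%E by rewrite ui le0_lneNy//= maxye.
  rewrite /= addye; last first.
    rewrite -ltNye; apply: (@lt_le_trans _ _ 0%E) => //.
    by apply: sume_ge0 => j _; rewrite le_max lexx orbT.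
  by rewrite addey ?leey// -EFinD.
have {}pos i : (i < k)%N -> 0 < u i.
  move=> ik; rewrite lt_neqAle u0 andbT eq_sym; apply/eqP => ui.
  by apply: pos; exists (Ordinal ik).
pose a i : R := Num.max (ln (u i)) 0; pose a' i : R := Num.max (- ln (u i)) 0.
have -> : (\sum_(i < k) maxe (lne (u i)%:E) 0 = (\sum_(i < k) a i)%:E)%E.
  by rewrite -sumEFin; apply: eq_bigr => i _; rewrite lne_EFin ?pos// EFin_max.
have -> : (\sum_(i < k) maxe (- lne (u i)%:E) 0 = (\sum_(i < k) a' i)%:E)%E.
  rewrite -sumEFin; apply: eq_bigr => i _.
  by rewrite lne_EFin ?pos// -EFinN EFin_max.
rewrite -!EFinD lee_fin.
have z0 : 0 < \prod_(i < k) u i by apply: prodr_gt0 => i _; exact: pos.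
have := @le_ln1Dx R (b * \prod_(i < k) u i - 1).
rewrite (_ : 1 + (_ - 1) = b * \prod_(i < k) u i); last by ring.
rewrite -subr_gt0 opprK subrK mulr_gt0// => /(_ isT).
rewrite lnM ?posrE// ln_prod//.
have -> : \sum_(i < k) ln (u i) = \sum_(i < k) a i - \sum_(i < k) a' i.
  rewrite -sumrB; apply: eq_bigr => i _; rewrite /a /a'.
  by have [l0|l0] := leP 0 (ln (u i)); [rewrite max_r ?oppr_le0// subr0|
     rewrite max_l ?oppr_ge0 ?ltW// sub0r opprK].
move: (\sum_(i < k) a i) (\sum_(i < k) a' i) (b * _) (ln b) => *; lra.
Qed.

Context {d d'} {Omega : measurableType d} {T : measurableType d'}.
Variables (P : probability Omega R) (Y : nat -> {RV P >-> T}) (n : nat).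
Variables (mu : probability T R) (iidY : iid P Y mu).
Variables (B : set Omega) (mB : measurable B) (b : R) (b0 : 0 < b) (PB : P B = b%:E).

(** The density with respect to [P] of [P] conditioned on [B]. *)
Let W w : R := \1_B w / b.

Lemma measurable_cond_weight : measurable_fun [set: Omega] W.
Proof. by apply: measurable_funM => //; exact: measurable_indic. Qed.

Lemma cond_weight_ge0 w : 0 <= W w.
Proof. by rewrite divr_ge0// ltW. Qed.

Lemma integral_cond_weight : (\int[P]_w (W w)%:E = 1)%E.
Proof.
under eq_integral do rewrite /W mulrC EFinM.
rewrite ge0_integralZl//; last by rewrite lee_fin invr_ge0 ltW.
  have -> : (\int[P]_w (\1_B w)%:E = b%:E)%E by rewrite integral_indic// setIT.
  by rewrite -EFinM mulVf// gt_eqF.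
by apply/measurable_EFinP; exact: measurable_indic.
Qed.

Let mW := measurable_cond_weight.
Let W0 := cond_weight_ge0.
Let W1 := integral_cond_weight.

(* Csiszar: the conditional mean of the empirical measure given [B] has relative
   entropy at most [- ln (P B) / (n + 1)]; Jensen's inequality is applied to
   [ln \prod_i f (Y i)], where [f] is the density of the conditional mean. *)
Lemma cond_empirical_entropy :
  (relative_entropy (weighted_empirical Y n mW W0 W1) mu <= (- ln b / n.+1%:R)%:E)%E.
Proof.
set nu := weighted_empirical _ _ _ _ _.
have [f df nuf] := @dominates_has_density _ _ _ mu nu
  (weighted_empirical_dominates n mW W0 W1 iidY).
have [mf f0 f1] := df.
have nfin := integral_lne_neg df nuf.
rewrite (relative_entropy_posneg df nuf).
have ml : measurable_fun [set: T] (fun x => lne (f x)%:E) by exact: measurable_lne.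
have mn : measurable_fun [set: T] (fun x => lm (f x)).
  by apply: measurable_maxe => //; apply: measurableT_comp.
have mp : measurable_fun [set: T] (fun x => lp (f x)).
  exact: measurable_maxe.
have mEW : measurable_fun [set: Omega] (EFin \o W) by exact/measurable_EFinP.
have mY i (g : T -> \bar R) : measurable_fun [set: T] g ->
    measurable_fun [set: Omega] (fun w => (g (Y i w) * (W w)%:E)%E).
  move=> mg; apply: emeasurable_funM => //.
  exact: (measurableT_comp mg (measurable_RV Y i)).
have Wpos w : (0 <= (W w)%:E)%E by rewrite lee_fin.
have b1 : 0 <= - ln b.
  by rewrite oppr_ge0 ln_le0// -lee_fin -PB; exact: probability_le1.
pose z w := \prod_(i < n.+1) f (Y i w).
have z0 w : 0 <= z w by apply: prodr_ge0.
have mz : measurable_fun [set: Omega] (EFin \o z).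
  by apply/measurable_EFinP; exact: (measurable_iid_prod Y df n.+1).
have mlnb : measurable_fun [set: Omega] (fun w => (- ln b)%:E * (W w)%:E)%E.
  exact: emeasurable_funM.
have lnb0 w : (0 <= (- ln b)%:E * (W w)%:E)%E by rewrite mule_ge0// lee_fin.
have msum (g : T -> \bar R) : measurable_fun [set: T] g ->
    measurable_fun [set: Omega] (fun w => (\sum_(i < n.+1) g (Y i w)) * (W w)%:E)%E.
  move=> mg; apply: emeasurable_funM => //; apply: emeasurable_sum => i.
  exact: (measurableT_comp mg (measurable_RV Y i)).
have sum0 (g : T -> \bar R) w : (forall y, 0 <= g y)%E ->
    (0 <= (\sum_(i < n.+1) g (Y i w)) * (W w)%:E)%E.
  by move=> g0; apply: mule_ge0 => //; apply: sume_ge0.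
(* [lne_prod_le] is integrated against [W P]. Since [b W <= 1], the product term is at most the
   [P]-integral of [z], which is 1 by [integral_iid_prod]. *)
have key : (\int[P]_w ((\sum_(i < n.+1) lp (f (Y i w))) * (W w)%:E) + 1 <=
    1 + (- ln b)%:E + \int[P]_w ((\sum_(i < n.+1) lm (f (Y i w))) * (W w)%:E))%E.
  have -> : (1 + (- ln b)%:E =
      \int[P]_w ((z w)%:E + (- ln b)%:E * (W w)%:E))%E.
    rewrite ge0_integralD//; last by move=> w _; rewrite lee_fin.
    rewrite (integral_iid_prod iidY df n.+1) ge0_integralZl//.
    by rewrite W1 mule1.
  rewrite -[X in (_ + X <= _)%E]W1 -ge0_integralD//; last 2 first.
  - by move=> w _; exact: (sum0 (lp \o f) w (fun y => lp0 (f y))).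
  - exact: (msum (lp \o f)).
  have zl0 w : (0 <= (z w)%:E + (- ln b)%:E * (W w)%:E)%E.
    by apply: adde_ge0 => //; rewrite lee_fin.
  rewrite -ge0_integralD//; first last.
  - exact: (msum (lm \o f)).
  - by move=> w _; exact: (sum0 (lm \o f) w (fun y => ln0 (f y))).
  - exact: emeasurable_funD.
  apply: ge0_le_integral => //.
  - by move=> w _; apply: adde_ge0 => //; exact: (sum0 (lp \o f) w (fun y => lp0 (f y))).
  - by apply: emeasurable_funD => //; exact: (msum (lp \o f)).
  - by apply: emeasurable_funD; [exact: emeasurable_funD|exact: (msum (lm \o f))].
  move=> w _.
  have spos (g : R -> \bar R) : (forall t, 0 <= g t)%E ->
    (0 <= \sum_(i < n.+1) g (f (Y i w)))%E by move=> g0; exact: sume_ge0.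
  have bz0 : (0 <= (b * z w)%:E + (- ln b)%:E)%E.
    by rewrite -EFinD lee_fin addr_ge0// mulr_ge0// ltW.
  have main := @lne_prod_le b (fun i => f (Y i w)) n.+1 b0 (fun i => f0 _).
  have := lee_wpmul2r (Wpos w) main.
  rewrite ge0_muleDl//; last exact: (spos lp).
  rewrite mul1e => /le_trans; apply.
  rewrite [leLHS]ge0_muleDl; [|exact: bz0|exact: (spos lm ln0)].
  rewrite leeD2r//.
  rewrite -EFinD -!EFinM -EFinD lee_fin mulrDl lerD2r /W indicE.
  case: (_ \in _); rewrite /= ?mul0r ?mulr0//.
  by rewrite mul1r mulrAC divff ?gt_eqF// mul1r.
have S (g : T -> \bar R) : measurable_fun [set: T] g -> (forall y, 0 <= g y)%E ->
   (\int[P]_w ((\sum_(i < n.+1) g (Y i w)) * (W w)%:E) =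
   (n.+1%:R)%:E * \int[nu]_y g y)%E.
  move=> mg g0; rewrite /nu integral_weighted_empirical// muleA -EFinM.
  rewrite divff// mul1e -ge0_integral_sum//; last 2 first.
  - by move=> i; exact: mY.
  - by move=> i w _; exact: mule_ge0.
  apply: eq_integral => w _; rewrite ge0_sume_distrl//.
have Sp := S _ mp (fun=> lp0 _); have Sn := S _ mn (fun=> ln0 _).
rewrite {}Sp {}Sn in key.
move: key nfin.
have : (0 <= \int[nu]_y lp (f y))%E by exact: integral_ge0.
change ((0 <= \int[nu]_y lp (f y) -> (n.+1%:R)%:E * \int[nu]_y lp (f y) + 1 <=
  1 + (- ln b)%:E + (n.+1%:R)%:E * \int[nu]_y lm (f y) ->
  \int[nu]_y lm (f y) \is a fin_num ->
  \int[nu]_y lp (f y) - \int[nu]_y lm (f y) <= (- ln b / n.+1%:R)%:E)%E).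
move: (\int[_]_y lp (f y))%E (\int[_]_y lm (f y))%E => I1 I2.
case: I2 => [i2||]//; case: I1 => [i1||]// _.
  rewrite -!EFinM -!EFinD !lee_fin => key _.
  rewrite ler_pdivlMr// mulrC; move: key.
  rewrite mulrBr; move: (_ * i1) (_ * i2) (ln b) => *; lra.
by rewrite gt0_muley ?lte_fin.
Qed.

End conditional_entropy.

(** * Events of the empirical Frechet mean: measurability and probability bounds *)

Section empirical_events.
Context {R : realType} {X : pmetricType R} (cX : compact [set: X]).
Variables (p : R) (p1 : 1 <= p).
Context {d} {Omega : measurableType d}.
Variables (P : probability Omega R) (Y : nat -> {RV P >-> borel X}) (n : nat).
Implicit Types (x y : X).

Local Notation fmean := (fmean p).
Local Notation F := (frechet_mean cX p1).
Local Notation cost x y := ((mdist x y) `^ p).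

Definition empirical_RV w : probability (borel X) R :=
  empirical n (fun i => Y i w).

Local Notation emp := empirical_RV.

Lemma fmean_empirical w x :
  fmean (emp w) x = n.+1%:R^-1 * \sum_(i < n.+1) cost x (Y i w).
Proof.
rewrite /fmean /frechet_fun (eq_measure_integral
  (mscale (n.+1%:R^-1 : R)%:nng (msum (fun i => \d_(Y i w)) n.+1)))//.
have mc := measurable_mdist_powR p x.
have c0 y : [set: borel X] y -> (0 <= (cost x y)%:E)%E by rewrite lee_fin powR_ge0.
rewrite ge0_integral_mscale// ge0_integral_measure_sum//.
under eq_bigr do rewrite integral_dirac// diracT mul1e.
by rewrite sumEFin -EFinM.
Qed.

Lemma measurable_fmean_empirical x :
  measurable_fun [set: Omega] (fun w => fmean (emp w) x).
Proof.
under eq_fun do rewrite fmean_empirical.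
apply: measurable_funM => //; apply: measurable_sum => i.
have mc : measurable_fun [set: borel X] (fun y => cost x y).
  exact: (measurableT_comp (measurable_powR p) (measurable_mdist x)).
exact: (measurableT_comp mc (measurable_RV Y i)).
Qed.

Lemma measurable_slab t : measurable [set w | slab p t (emp w)].
Proof.
rewrite (_ : [set _ | _] = \bigcap_(x in [set` t.1.1])
    [set w | `|fmean (emp w) x - t.1.2 x| <= t.2]); last first.
  by apply/seteqP; split => [w h x /= /h|w h x xt] //; exact: (h x xt).
apply: fin_bigcap_measurable; first exact: finite_seq.
move=> x _.
have mf : measurable_fun [set: Omega] (fun w => `|fmean (emp w) x - t.1.2 x|).
  apply: measurableT_comp => //; apply: measurable_funB => //.
  exact: measurable_fmean_empirical.
rewrite (_ : [set _ | _] = (fun w => `|fmean (emp w) x - t.1.2 x|) @^-1` `]-oo, t.2]).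
  by rewrite -[X in measurable X]setTI; exact: mf.
by apply/seteqP; split => w /=; rewrite in_itv.
Qed.

(** The event is a countable union of slab events, each given by a finite net, rational values on it
    and the tolerance [1 / (m + 1)]; only slabs on which [V] holds throughout are kept. *)
Lemma measurable_open_event (V : set (kset X)) : open V ->
  measurable [set w | V (F (emp w))].
Proof.
move=> oV; have [L L0 LP] := fmean_lipschitz cX p1.
(* Two measures of one slab differ by at most [2 / (m + 1)] on its net, hence by at most
   [4 / (m + 1)] everywhere. *)
have /choice[net netP] : forall m : nat, exists s : seq X, forall phi psi : X -> R,
    lip L phi -> lip L psi -> {in s, forall x, `|phi x - psi x| <= 2 * m.+1%:R^-1} ->
    forall x, `|phi x - psi x| <= 2 * (2 * m.+1%:R^-1).
  by move=> m; apply: lip_net => //; rewrite mulr_gt0// invr_gt0.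
pose t (mq : nat * seq rat) : seq X * (X -> R) * R :=
  (net mq.1, (fun x => ratr (nth 0 mq.2 (index x (net mq.1)))), mq.1.+1%:R^-1).
pose good mq := forall nu', slab p (t mq) nu' -> V (F nu').
rewrite (_ : [set _ | _] = \bigcup_mq
   (if `[< good mq >] then [set w | slab p (t mq) (emp w)] else set0)).
  apply: countable_bigcupT_measurable => [|mq]; first exact: countableP.
  by case: ifPn => _; [exact: measurable_slab|exact: measurable0].
apply/seteqP; split => [w /= Vw|w [mq _]]; last first.
  by case: ifPn => [/asboolP g|_] //=; exact: g.
have [dl dl0 dlP] := frechet_mean_open oV Vw.
have [m m4] : exists m : nat, 4 * m.+1%:R^-1 <= dl.
  have := @cvg_harmonic R => /cvgrPdist_le/(_ (dl / 4)).
  rewrite divr_gt0// => /(_ isT)[m _ /(_ m (leqnn m))].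
  rewrite sub0r normrN ger0_norm//= => h; exists m.
  by rewrite mulrC -ler_pdivlMr.
have m0 : 0 < m.+1%:R^-1 :> R by rewrite invr_gt0.
have /choice[r rP] : forall x, exists r : rat,
    `|fmean (emp w) x - ratr r| <= m.+1%:R^-1.
  move=> x; have [|r] := @rat_in_itvoo R (fmean (emp w) x - m.+1%:R^-1)
      (fmean (emp w) x + m.+1%:R^-1).
    by rewrite ltrBlDr -addrA ltrDl addr_gt0.
  rewrite in_itv/= => /andP[r1 r2]; exists r; move: r1 r2.
  by move: (fmean _ x) (ratr r) (m.+1%:R^-1 : R) => q q' v *; rewrite ler_norml; apply/andP; split; lra.
pose q := map r (net m).
have qE x : x \in net m -> nth 0 q (index x (net m)) = r x.
  by move=> xm; rewrite (nth_map x) ?index_mem// nth_index.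
exists (m, q) => //; rewrite asboolT/=.
  by move=> x xm /=; rewrite qE.
move=> nu' nu'P; apply: dlP => x.
apply: (@le_trans _ _ (2 * (2 * m.+1%:R^-1))); last by rewrite mulrA -natrM.
move: x; apply: netP => // x xm.
have := rP x; have := nu'P x xm; rewrite /= qE// !ler_norml.
move: (fmean _ x) (fmean _ x) (ratr _ : R) (m.+1%:R^-1 : R) => a1 a2 a3 a4.
by move=> /andP[? ?] /andP[? ?]; apply/andP; split; lra.
Qed.

Lemma measurable_frechet_event (A : set (kset X)) : <<s @open (kset X) >> A ->
  measurable [set w | A (F (emp w))].
Proof.
move=> sA; apply: (sA [set A' | measurable [set w | A' (F (emp w))]]).
split; last by move=> V oV; exact: measurable_open_event.
split => [|A' /= mA'|A' /= mA'].
- exact: (@measurable0 _ Omega).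
- rewrite [X in measurable X](_ : _ = ~` [set w | A' (F (emp w))]).
    exact: measurableC.
  by apply/seteqP; split => [w [_ ?]|w ?].
- rewrite [X in measurable X](_ : _ = \bigcup_i [set w | A' i (F (emp w))]).
    exact: bigcupT_measurable.
  by apply/seteqP; split => w [i _ ?]; exists i.
Qed.

Variables (mu : probability (borel X) R) (iidY : iid P Y mu).

Local Notation H nu := (relative_entropy nu mu).

(** The conditional mean of the empirical measure given the slab event lies in the slab by
    convexity, so [a] is below its entropy, itself at most [- ln b / (n + 1)]. *)
Lemma slab_probability t (a : R) :
  (forall nu, slab p t nu -> (a%:E < H nu)%E) ->
  (P [set w | slab p t (emp w)] <= (expR (- a * n.+1%:R))%:E)%E.
Proof.
move=> ta; set B := [set w | _].
have mB : measurable B by exact: measurable_slab.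
have PBfin : P B \is a fin_num by exact: fin_num_measure.
pose b := fine (P B).
have PB : P B = b%:E by rewrite /b fineK.
have b_ge0 : 0 <= b by rewrite fine_ge0.
(* Conditioning needs a positive probability; a null event satisfies the bound at once. *)
have [b0|b_neq0] := eqVneq b 0.
  by rewrite [leLHS](_ : _ = b%:E)// b0 lee_fin expR_ge0.
have b0 : 0 < b by rewrite lt_neqAle eq_sym b_neq0.
pose W w : R := \1_B w / b.
pose mW : measurable_fun setT W := measurable_cond_weight mB b.
pose W0 : forall w, 0 <= W w := cond_weight_ge0 B b0.
pose W1 : (\int[P]_w (W w)%:E = 1)%E := integral_cond_weight mB b0 PB.
pose nu : probability (borel X) R := weighted_empirical Y n mW W0 W1.
have Hnu : (H nu <= (- ln b / n.+1%:R)%:E)%E := cond_empirical_entropy n iidY mB b0 PB.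
suff : slab p t nu.
  move=> /ta/lt_le_trans/(_ Hnu); rewrite lte_fin ltr_pdivlMr// => h.
  rewrite [leLHS](_ : _ = b%:E)// lee_fin -ler_ln ?posrE ?expR_gt0// expRK.
  by rewrite mulNr lerNr ltW.
have mg x : measurable_fun [set: Omega] (fun w => (fmean (emp w) x * W w)%:E).
  apply/measurable_EFinP/measurable_funM => //.
  exact: measurable_fmean_empirical.
have g0 w x : 0 <= fmean (emp w) x.
  by rewrite fmean_empirical mulr_ge0// sumr_ge0// => i _; exact: powR_ge0.
have nuE x : ((fmean nu x)%:E = \int[P]_w (fmean (emp w) x * W w)%:E)%E.
  rewrite fmeanE// /frechet_fun (integral_weighted_empirical Y n mW W0 W1); first last.
  - by move=> y; rewrite lee_fin powR_ge0.
  - exact: measurable_mdist_powR.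
  have mc i : measurable_fun [set: Omega]
      (fun w => ((cost x (Y i w))%:E * (W w)%:E)%E).
    apply: emeasurable_funM; last exact/measurable_EFinP.
    exact: (measurableT_comp (measurable_mdist_powR p x) (measurable_RV Y i)).
  have c0 i w : (0 <= (cost x (Y i w))%:E * (W w)%:E)%E.
    by rewrite mule_ge0// lee_fin// powR_ge0.
  rewrite -ge0_integral_sum// -ge0_integralZl//; first last.
  - by move=> w _; apply: sume_ge0 => i _; exact: c0.
  - by apply: emeasurable_sum => i.
  apply: eq_integral => w _; rewrite fmean_empirical.
  under eq_bigr do rewrite -EFinM.
  by rewrite sumEFin -EFinM -mulr_suml mulrA.
have wB w : W w != 0 -> B w.
  by apply: contra_neqP => Bw; rewrite /W indicE memNset// mul0r.
(* [fmean nu x] averages values taken on [B], so bounds valid on [B] survive. The sign of [q] is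
   settled first, here and in [lo], to compare nonnegative integrands. *)
have up (q : R) x : (forall w, B w -> fmean (emp w) x <= q) -> fmean nu x <= q.
  move=> h; have q0 : 0 <= q.
    have [[w Bw]|B0] := pselect (exists w, B w).
      exact: le_trans (g0 w x) (h w Bw).
    exfalso; move: b_neq0; rewrite /b (_ : B = set0) ?measure0 ?eqxx//.
    by apply/seteqP; split => // w Bw; apply: B0; exists w.
  rewrite -lee_fin nuE.
  rewrite -[leRHS]mule1 -W1 -ge0_integralZl//; last 2 first.
  - exact/measurable_EFinP.
  - by move=> w _; rewrite lee_fin.
  apply: ge0_le_integral => //.
  - by move=> w _; rewrite lee_fin mulr_ge0.
  - by apply: emeasurable_funM => //; exact/measurable_EFinP.
  move=> w _; rewrite -EFinM lee_fin.
  have [->|/wB Bw] := eqVneq (W w) 0; first by rewrite !mulr0.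
  by rewrite ler_wpM2r// h.
have lo (q : R) x : (forall w, B w -> q <= fmean (emp w) x) -> q <= fmean nu x.
  move=> h; have [q0|/ltW q0] := leP q 0.
    rewrite (le_trans q0)// -lee_fin nuE; apply: integral_ge0 => w _.
    by rewrite lee_fin mulr_ge0.
  rewrite -lee_fin nuE.
  rewrite -[leLHS]mule1 -W1 -ge0_integralZl//; last 2 first.
  - exact/measurable_EFinP.
  - by move=> w _; rewrite lee_fin.
  apply: ge0_le_integral => //.
  - by move=> w _; rewrite -EFinM lee_fin mulr_ge0.
  - by apply: emeasurable_funM => //; exact/measurable_EFinP.
  move=> w _; rewrite -EFinM lee_fin.
  have [->|/wB Bw] := eqVneq (W w) 0; first by rewrite !mulr0.
  by rewrite ler_wpM2r// h.
move=> x xt; rewrite ler_norml lerBrDr lerBlDr; apply/andP; split.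
  apply: lo => w /(_ x xt); rewrite ler_norml => /andP[+ _].
  by rewrite lerBrDr.
by apply: up => w /(_ x xt); rewrite ler_norml => /andP[_]; rewrite lerBlDr.
Qed.

Lemma cover_probability (s : seq (seq X * (X -> R) * R)) (a : R) (E : set Omega) :
  {in s, forall t nu, slab p t nu -> (a%:E < H nu)%E} -> measurable E ->
  (forall w, E w -> exists2 t, t \in s & slab p t (emp w)) ->
  (P E <= ((size s)%:R * expR (- a * n.+1%:R))%:E)%E.
Proof.
elim: s E => [|t s ih] E sa mE Es.
  rewrite (_ : E = set0) ?measure0 ?mul0r//.
  by apply/seteqP; split => // w /Es[].
pose B := [set w | slab p t (emp w)].
have mB : measurable B by exact: measurable_slab.
apply: (@le_trans _ _ (P (B `|` (E `\` B)))).
  apply: le_measure; rewrite ?inE//.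
    by apply: measurableU => //; exact: measurableD.
  by move=> w Ew; have [Bw|Bw] := pselect (B w); [left|right].
apply: (le_trans (measureU2 _ _ _)) => //; first exact: measurableD.
rewrite /= mulrSr mulrDl mul1r addrC EFinD; apply: leeD; last by apply: slab_probability; exact: sa (mem_head _ _).
apply: ih.
- by move=> u us; apply: sa; rewrite inE us orbT.
- exact: measurableD.
- move=> w [/Es[u] + ut nB]; rewrite inE => /predU1P[eut|us]; last by exists u.
  by exfalso; apply: nB; rewrite /B /= -eut.
Qed.

End empirical_events.

(** * Upper limits in the extended reals *)

Section limsup_bounds.
Context {R : realType}.

(** Testing real levels below [i] suffices for infinite [i] too: at [+oo] all levels are tested, at
    [-oo] the conclusion is trivial. *)
Lemma le_oppe_ereal (x i : \bar R) :
  (forall a : R, (a%:E < i)%E -> (x <= (- a)%:E)%E) -> (x <= - i)%E.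
Proof.
case: i => [i h|h|_]; last by rewrite leey.
  apply/lee_addgt0Pr => e e0; have := h (i - e).
  rewrite lte_fin gtrBl e0 => /(_ isT)/le_trans; apply.
  by rewrite -EFinN -EFinD lee_fin opprB addrC.
case: x h => [x||] h //.
- by have := h (1 - x)%R (ltry _); rewrite lee_fin => ?; exfalso; lra.
- by have := h 0 (ltry _).
Qed.

Lemma limn_esup_le (u : (\bar R)^nat) (v : R^nat) (l : R) :
  (forall n, (u n <= (v n)%:E)%E) -> v @ \oo --> l -> (limn_esup u <= l%:E)%E.
Proof.
move=> uv vl; apply/lee_addgt0Pr => e e0; rewrite limn_esup_lim.
apply: lime_le; first exact: is_cvg_esups.
move/cvgrPdist_le : vl => /(_ e e0)[N _ Nv].
exists N => // n /= Nn; apply: ge_ereal_sup => _ [m /= nm <-].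
apply: (le_trans (uv m)); rewrite -EFinD lee_fin.
have := Nv m (leq_trans Nn nm); rewrite /= ler_norml => /andP[h _].
by move: (v m) h => ? ?; lra.
Qed.

End limsup_bounds.

(** * Large deviation upper bound for the empirical Frechet mean *)

Section deviations.
Context {R : realType} {X : pmetricType R} (cX : compact [set: X]).
Variables (p : R) (p1 : 1 <= p) (mu : probability (borel X) R).

Local Notation F := (frechet_mean cX p1).
Local Notation H nu := (relative_entropy nu mu).

(** [N] is fixed before the probability space, the sample and [n], which makes the constants
    uniform. The successor keeps the factor positive even for an empty cover. *)
Lemma frechet_mean_upper_bound (V : set (kset X)) (a : R) : open V ->
  (forall nu, (H nu <= a%:E)%E -> V (F nu)) ->
  exists N : nat, forall (d : measure_display) (Omega : measurableType d)
    (P : probability Omega R) (Y : nat -> {RV P >-> borel X}),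
  iid P Y mu -> forall n (E : set Omega), measurable E ->
  (forall w, E w -> ~ V (F (empirical_RV Y n w))) ->
  (P E <= (N.+1%:R * expR (- a * n.+1%:R))%:E)%E.
Proof.
move=> oV aV; have [s sa sV] := bad_cover oV aV.
exists (size s) => d Omega P Y iidY n E mE EV.
apply: (@le_trans _ _ ((size s)%:R * expR (- a * n.+1%:R))%:E).
  have := cover_probability cX p1 iidY sa mE.
  by move=> h; apply: h => w /EV; exact: sV.
by rewrite lee_fin ler_wpM2r ?expR_ge0// ler_nat.
Qed.

Lemma frechet_mean_limsup (A : set (kset X)) (a : R)
    (d : measure_display) (Omega : measurableType d)
    (P : probability Omega R) (Y : nat -> {RV P >-> borel X}) :
  iid P Y mu -> <<s @open (kset X) >> A ->
  (a%:E < ereal_inf [set rate cX p1 mu C | C in closure A])%E ->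
  (limn_esup (fun n => (n.+1%:R^-1)%:E *
     lne (P [set w | A (F (empirical_RV Y n w))])) <= (- a)%:E)%E.
Proof.
move=> iidY sA ai.
(* A measure with [H nu <= a] and Frechet mean in the closure would give a rate at most [a] there,
   below the infimum. *)
have [|nu nua|N NP] := @frechet_mean_upper_bound (~` closure A) a.
- by apply: closed_openC; exact: closed_closure.
- move=> /= AF; have : (ereal_inf [set rate cX p1 mu C | C in closure A] <= a%:E)%E.
    apply: (@le_trans _ _ (rate cX p1 mu (F nu))).
      by apply: ereal_inf_lbound; exists (F nu).
    by apply: le_trans nua; exact: rate_le.
  by rewrite leNgt ai.
have N0 : 0 < N.+1%:R :> R by [].
(* This is the logarithm of the bound divided by [n + 1]; the factor [N + 1] disappears in the
   limit. *)
apply: (@limn_esup_le R _ (fun n => ln N.+1%:R / n.+1%:R - a)) => [n|]; last first.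
  rewrite -[X in _ --> X]sub0r; apply: cvgB; last exact: cvg_cst.
  rewrite -(mulr0 (ln N.+1%:R)); apply: cvgM; first exact: cvg_cst.
  exact: cvg_harmonic.
set E := [set w | _].
have mE : measurable E by exact: measurable_frechet_event.
have PE : (P E <= (N.+1%:R * expR (- a * n.+1%:R))%:E)%E.
  by apply: (NP _ _ _ _ iidY n E mE) => w Aw /=; apply; exact: subset_closure.
have c0 : 0 < N.+1%:R * expR (- a * n.+1%:R) by rewrite mulr_gt0 ?expR_gt0.
have : (lne (P E) <= (ln (N.+1%:R * expR (- a * n.+1%:R)))%:E)%E.
  rewrite -lne_EFin// lee_lne// in_itv/= leey andbT; first exact: measure_ge0.
  by rewrite lee_fin ltW.
rewrite lnM ?posrE ?expR_gt0// expRK => h.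
have n0 : (0 <= (n.+1%:R^-1 : R)%:E)%E by rewrite lee_fin.
apply: (le_trans (lee_wpmul2l n0 h)).
rewrite -EFinM lee_fin mulrDr mulNr mulrN [_^-1 * ln _]mulrC.
by rewrite [a * _]mulrC mulKf.
Qed.

Lemma open_rho_lt (K : kset X) (e : R) :
  open [set C : kset X | rho C K < e].
Proof.
rewrite openE => C /= CK; exists (e - rho C K) => [|C' /=].
  by rewrite /= subr_gt0.
by rewrite ltrBrDr; apply: le_lt_trans; exact: rho_triangle.
Qed.

End deviations.

Theorem theorem4p10 (R : realType) (X : pmetricType R) (cX : compact [set: X])
    (p : R) (p1 : 1 <= p) (mu : probability (borel X) R) :
  [/\ (forall C : kset X, (0 <= rate cX p1 mu C)%E),
      (forall alpha : R,
        cover_compact [set C : kset X | (rate cX p1 mu C <= alpha%:E)%E]),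
      (forall (d : measure_display) (Omega : measurableType d)
          (P : probability Omega R) (Y : nat -> {RV P >-> borel X}),
        measure_is_complete P -> iid P Y mu ->
        forall A : set (kset X), <<s @open (kset X) >> A ->
        (limn_esup (fun n => (n.+1%:R^-1)%:E *
            lne (P [set w | A (frechet_mean cX p1
                                 (empirical n (fun i => Y i w)))]))
         <= - ereal_inf [set rate cX p1 mu C | C in closure A])%E) &
      (forall eps : R, 0 < eps ->
        exists c1 c2 : R, [/\ 0 < c1, 0 < c2 &
          forall (d : measure_display) (Omega : measurableType d)
            (P : probability Omega R) (Y : nat -> {RV P >-> borel X}),
          measure_is_complete P -> iid P Y mu ->
          forall n : nat,
          (P [set w | (eps <= rho (frechet_mean cX p1
                                     (empirical n (fun i => Y i w)))
                                  (frechet_mean cX p1 mu))%R]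
           <= (c1 * expR (- c2 * n.+1%:R))%:E)%E])].
Proof.
split; [exact: rate_ge0|exact: rate_compact| |].
- move=> d Omega P Y _ iidY A sA; apply: le_oppe_ereal => a ai.
  exact: frechet_mean_limsup iidY sA ai.
(* The entropy gap [a] serves as the decay rate [c2], the open set is the [e]-neighborhood of the
   Frechet mean of [mu], and [c1] comes from the size of the slab cover. *)
move=> e e0; have [a a0 aP] := entropy_gap cX p1 mu e0.
have [|nu nua|N NP] := @frechet_mean_upper_bound _ _ cX _ p1 mu
  [set C : kset X | rho C (frechet_mean cX p1 mu) < e] a.
- exact: open_rho_lt.
- exact: aP.
exists N.+1%:R, a; split => // d Omega P Y _ iidY n.
apply: (NP _ _ _ _ iidY) => [|w /= eF]; last by apply/negP; rewrite -leNgt.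
rewrite (_ : [set w | _] = ~` [set w | rho (frechet_mean cX p1
    (empirical_RV Y n w)) (frechet_mean cX p1 mu) < e]).
  apply: measurableC.
  exact: (measurable_open_event cX p1 Y n (@open_rho_lt _ _ (frechet_mean cX p1 mu) e)).
by apply/seteqP; split => w /=; [move=> h; apply/negP; rewrite -leNgt|move/negP; rewrite -leNgt].
Qed.
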